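(* Let $m\ge 2$ and let $H\in\mathcal{T}_m$ be a tree. Let $G$ be a unicyclic graph constructed from $H$ by adding (a) an edge between a pendant vertex of $H$ and the center of $H$, or (b) an edge between two pendant vertices of $H$, or (c) an edge between the center of $H$ and an internal vertex of $H$. Then the edge-binomials of $G$ form a $d$-sequence in $S$. In particular, $J_G$ is of linear type.
   Context: All graphs are finite and simple; a unicyclic graph contains exactly one cycle. $G$ has vertex set identified with $[n]$, and $S=k[x_1,\ldots,x_n,y_1,\ldots,y_n]$ over a field $k$. The edge-binomial of an edge $\{i,j\}$ is $f_{ij}=x_iy_j-x_jy_i$, and $J_G=(f_{ij}\mid\{i,j\}\in E(G))$ is the binomial edge ideal. An ideal is of linear type if the canonical map from its symmetric algebra to its Rees algebra is an isomorphism. $d$-sequence: let $R$ be a commutative ring and $a_0=0$. A sequence $a_1,\ldots,a_r$ in $R$ is a $d$-sequence if (i) $a_1,\ldots,a_r$ is a minimal system of generators of $(a_1,\ldots,a_r)$, and (ii) $(a_0,\ldots,a_i):a_{i+1}a_j=(a_0,\ldots,a_i):a_j$ for all $0\le i\le r-1$ and all $j\ge i+1$. ''The edge-binomials of $G$ form a $d$-sequence'' means that the set of all edge-binomials of $G$ can be arranged in some order that is a $d$-sequence. The class $\mathcal{T}_m$ ($m\ge 2$): trees $H$ with vertex set $\{k_0\}\cup\{p_{i,j}: 1\le i\le m,\ 1\le j\le s(i)+1\}$, where $s(i)\ge 0$ for all $i$, and edge set $\{\{k_0,p_{i,1}\}:1\le i\le m\}\cup\bigcup_{i=1}^m\{\{p_{i,j},p_{i,j+1}\}:1\le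 j\le s(i)\}$. The vertex $k_0$ is the center of $H$ (for $m=2$, $H$ is a path with a designated non-end vertex $k_0$). A pendant vertex is a vertex of degree $1$; an internal vertex of the tree $H$ is a vertex of degree at least $2$. Adding an edge to $H$ means joining two distinct non-adjacent vertices of $H$. *)

(* Defs.v *)
From HB Require Import structures.
From mathcomp Require Import all_boot all_order all_algebra.
From mathcomp Require Import ring_quotient.
From mathcomp Require Import boolp finmap.
From mathcomp Require Import mpoly monalg.

Set Warnings "-redundant-canonical-projection,-projection-no-head-constant".

Set Implicit Arguments.
Unset Strict Implicit.
Unset Printing Implicit Defensive.

Import GRing.Theory.
Local Open Scope ring_scope.

(* monalg and mpoly both define this notation, in different scopes; here it
   always denotes the polynomial ring of mpoly. *)
Notation "{ 'mpoly' R [ n ] }" := (mpoly.mpoly n R) : type_scope.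

Section Ideals.
Variable R : comNzRingType.
Implicit Types (A : R -> Prop) (s : seq R) (x : R).

Definition ideal_gen A : {pred R^o} :=
  fun x => `[< exists2 t : seq (R * R), forall u, u \in t -> A u.2 &
                 x = \sum_(u <- t) u.1 * u.2 >].

Definition ideal_seq s : {pred R^o} := ideal_gen (fun x => x \in s).

Lemma ideal_gen_closed A : submod_closed (ideal_gen A).
Proof.
split=> [|r x y /asboolP[t At ->] /asboolP[w Aw ->]].
  by apply/asboolP; exists [::] => //; rewrite big_nil.
apply/asboolP; exists ([seq (r * u.1, u.2) | u <- t] ++ w).
  by move=> u; rewrite mem_cat => /orP[/mapP[v /At Av ->] //|/Aw].
rewrite big_cat big_map; congr (_ + _); rewrite scaler_sumr.
by apply: eq_bigr => u _; apply: mulrA.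
Qed.

HB.instance Definition _ A :=
  GRing.isSubmodClosed.Build R R^o (ideal_gen A) (ideal_gen_closed A).

Lemma ideal_gen_sub A x : A x -> x \in ideal_gen A.
Proof.
move=> Ax; apply/asboolP; exists [:: (1, x)]; last by rewrite big_seq1 mul1r.
by move=> u; rewrite inE => /eqP->.
Qed.

Definition colon (I : {pred R^o}) x : {pred R^o} := fun z => z * x \in I.

Definition minimal_generators s :=
  forall t, subseq t s -> ideal_seq t =i ideal_seq s -> t = s.

(* The list is indexed from 0, so that s`_i is a_(i+1) and take i s is
   a_1, ..., a_i; the generator a_0 = 0 is omitted. *)
Definition d_sequence s :=
  minimal_generators s /\
  forall i j, (i <= j < size s)%N ->
    colon (ideal_seq (take i s)) (s`_i * s`_j) =i
    colon (ideal_seq (take i s)) s`_j.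

Fixpoint ideal_pow (I : {pred R^o}) n : {pred R^o} :=
  if n is n'.+1 then
    ideal_gen (fun x => exists a b, [/\ a \in I, b \in ideal_pow I n' & x = a * b])
  else predT.

End Ideals.

(* The symmetric algebra of a module M: the polynomial algebra with one
   variable [m] for each m in M, modulo the ideal generated by the elements
   [r m + m'] - r [m] - [m']. *)
Section SymmetricAlgebra.
Variables (R : comNzRingType) (M : lmodType R).

Definition free_alg : Type := {malg R[{cmonom M}]}.
HB.instance Definition _ := GRing.ComAlgebra.on free_alg.

Definition free_var (m : M) : free_alg := << ucm m >>.

Section Evaluation.
Variables (A : comAlgType R) (h : M -> A).

Definition monom_eval (m : {cmonom M}) : A := \prod_(i <- finsupp m) h i ^+ m i.

Lemma monom_evalEw (m : {cmonom M}) (d : {fset M}) : (finsupp m `<=` d)%fset ->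
  monom_eval m = \prod_(i <- d) h i ^+ m i.
Proof.
move=> le; rewrite /monom_eval (big_fset_incl _ le) // => i _.
by rewrite -cmE_neq0 negbK => /eqP->.
Qed.

Lemma monom_eval_mmorphism : mmorphism monom_eval.
Proof.
split=> [m1 m2|]; last by rewrite /monom_eval mdom1 big_seq_fset0.
have s1 : (finsupp m1 `<=` finsupp (mmul m1 m2))%fset by rewrite mdomD fsubsetUl.
have s2 : (finsupp m2 `<=` finsupp (mmul m1 m2))%fset by rewrite mdomD fsubsetUr.
rewrite (monom_evalEw s1) (monom_evalEw s2) -big_split /=.
by apply: eq_bigr => i _; rewrite cmM exprD.
Qed.

HB.instance Definition _ :=
  isMultiplicative.Build {cmonom M} A monom_eval monom_eval_mmorphism.

Definition free_eval : free_alg -> A := mmap (in_alg A) monom_eval.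

HB.instance Definition _ := GRing.RMorphism.on free_eval.

Lemma free_evalB p q : free_eval (p - q) = free_eval p - free_eval q.
Proof. exact: rmorphB. Qed.

Lemma free_evalM p q : free_eval (p * q) = free_eval p * free_eval q.
Proof. exact: rmorphM. Qed.

Lemma free_evalZ r p : free_eval (r *: p) = r *: free_eval p.
Proof. by rewrite /free_eval mmapZ /= mulr_algl. Qed.

Lemma free_eval_var m : free_eval (free_var m) = h m.
Proof.
by rewrite /free_eval mmapU /= scale1r mul1r /monom_eval mdomU big_seq_fset1 cmUU.
Qed.

End Evaluation.

Definition sym_rel : {pred free_alg} :=
  ideal_gen (fun p : free_alg => exists (r : R) (m m' : M),
    p = free_var (r *: m + m') - r *: free_var m - free_var m').

Lemma free_eval_rel (A : comAlgType R) (h : {linear M -> A}) p :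
  p \in sym_rel -> free_eval h p = 0.
Proof.
case/asboolP=> t rel ->; rewrite rmorph_sum /= big_seq big1 // => u /rel.
case=> r [m [m' E]]; have uE : free_eval h u.2 = 0.
  rewrite E !free_evalB free_evalZ.
  transitivity (h (r *: m + m') - r *: h m - h m').
    by congr (_ - r *: _ - _); exact: free_eval_var.
  by rewrite linearP addrAC addrK subrr.
by rewrite free_evalM uE mulr0.
Qed.

Lemma sym_rel_idealr : idealr_closed sym_rel.
Proof.
have [rel0 relP] := @ideal_gen_closed free_alg (fun p : free_alg =>
  exists (r : R) (m m' : M),
    p = free_var (r *: m + m') - r *: free_var m - free_var m').
split=> //; apply/negP => /(@free_eval_rel R^o \0).
by rewrite rmorph1 => /eqP; rewrite oner_eq0.
Qed.

HB.instance Definition _ := isIdealr.Build free_alg sym_rel sym_rel_idealr.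

Definition sym_alg : Type := {ideal_quot sym_rel}.
HB.instance Definition _ := GRing.ComNzRing.on sym_alg.

Definition sym_proj (p : free_alg) : sym_alg := \pi_{ideal_quot sym_rel}%qT p.

(* The algebra morphism Sym(M) -> A induced by a linear map h : M -> A; it does
   not depend on the representative, by sym_liftE below. *)
Definition sym_lift (A : comAlgType R) (h : {linear M -> A}) (u : sym_alg) : A :=
  free_eval h (repr (u : {ideal_quot sym_rel})).

Section Lift.
Variables (A : comAlgType R) (h : {linear M -> A}).

Lemma sym_liftE p : sym_lift h (sym_proj p) = free_eval h p.
Proof.
apply/eqP; rewrite -subr_eq0 -free_evalB; apply/eqP/free_eval_rel.
by rewrite Quotient.idealrBE reprK.
Qed.

Lemma sym_lift_var m : sym_lift h (sym_proj (free_var m)) = h m.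
Proof. by rewrite sym_liftE free_eval_var. Qed.

Lemma sym_projK u : sym_proj (repr (u : {ideal_quot sym_rel})) = u.
Proof. exact: reprK. Qed.

Lemma sym_lift_zmod_morphism : zmod_morphism (sym_lift h).
Proof.
move=> u v; rewrite -(sym_projK u) -(sym_projK v) /sym_proj.
by rewrite -[X in sym_lift h X](raddfB \pi_{ideal_quot sym_rel}%qT) !sym_liftE free_evalB.
Qed.

Lemma sym_lift_monoid_morphism : monoid_morphism (sym_lift h).
Proof.
split=> [|u v].
  by rewrite -[X in sym_lift h X](rmorph1 \pi_{ideal_quot sym_rel}%qT) sym_liftE rmorph1.
rewrite -(sym_projK u) -(sym_projK v) /sym_proj.
by rewrite -[X in sym_lift h X](rmorphM \pi_{ideal_quot sym_rel}%qT) !sym_liftE free_evalM.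
Qed.

HB.instance Definition _ := GRing.isZmodMorphism.Build sym_alg A (sym_lift h)
  sym_lift_zmod_morphism.
HB.instance Definition _ := GRing.isMonoidMorphism.Build sym_alg A (sym_lift h)
  sym_lift_monoid_morphism.

End Lift.
End SymmetricAlgebra.

Section Rees.
Variables (R : comNzRingType) (I : submodClosed R^o).

Definition ideal_module : Type := {x : R^o | x \in I}.
HB.instance Definition _ := SubChoice.on ideal_module.
HB.instance Definition _ := [SubChoice_isSubLmodule of ideal_module by <:].

Lemma ideal_pow_closed n : submod_closed (ideal_pow I n).
Proof. by case: n => [|n]; [split | apply: ideal_gen_closed]. Qed.

HB.instance Definition _ n :=
  GRing.isSubmodClosed.Build R R^o (ideal_pow I n) (ideal_pow_closed n).

Lemma ideal_powM i j x y :
  x \in ideal_pow I i -> y \in ideal_pow I j -> x * y \in ideal_pow I (i + j).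
Proof.
elim: i x => [|i IHi] x xI yI; first exact: (rpredZ x yI).
case/asboolP: xI => t tP ->; rewrite mulr_suml big_seq.
apply: (@rpred_sum _ (ideal_pow I (i.+1 + j))) => u /tP[a [b [aI bI ->]]].
rewrite -mulrA; apply: (rpredZ u.1); apply: ideal_gen_sub.
by exists a, (b * y); rewrite mulrA; split=> //; apply: IHi.
Qed.

(* The Rees algebra, the sum of the I^n t^n inside R[t], where t is 'X. *)
Definition rees_pred : {pred {poly R}} :=
  fun p => `[< forall i, p`_i \in ideal_pow I i >].

Lemma rees_closed : subalg_closed rees_pred.
Proof.
split=> [|r p q /asboolP pP /asboolP qP|p q /asboolP pP /asboolP qP].
- by apply/asboolP => -[|i]; rewrite coef1 // rpred0.
- by apply/asboolP => i; rewrite coefD coefZ; apply: rpredD => //; apply: rpredZ.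
apply/asboolP => i; rewrite coefM.
apply: (@rpred_sum _ (ideal_pow I i)) => j _.
by have := ideal_powM (pP j) (qP (i - j)%N); rewrite subnKC // -ltnS.
Qed.

HB.instance Definition _ :=
  GRing.isSubalgClosed.Build R {poly R} rees_pred rees_closed.

Definition rees_alg : Type := {p : {poly R} | p \in rees_pred}.
HB.instance Definition _ := SubChoice.on rees_alg.
HB.instance Definition _ := [SubChoice_isSubAlgebra of rees_alg by <:].
HB.instance Definition _ := [SubNzRing_isSubComNzRing of rees_alg by <:].

Lemma rees_gen_subproof (a : ideal_module) : val a *: 'X \in rees_pred.
Proof.
apply/asboolP => i; rewrite coefZ coefX; case: i => [|[|i]] //=.
- rewrite mulr1; apply: ideal_gen_sub.
  by exists (val a), 1; rewrite mulr1; split=> //; apply: (valP a).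
- by rewrite mulr0 rpred0.
Qed.

Definition rees_gen (a : ideal_module) : rees_alg :=
  Sub (val a *: 'X) (rees_gen_subproof a).

Lemma rees_gen_linear : linear rees_gen.
Proof.
by move=> r a b; apply: val_inj; rewrite /= scalerDl scalerA.
Qed.

HB.instance Definition _ :=
  GRing.isLinear.Build R ideal_module rees_alg *:%R rees_gen rees_gen_linear.

(* The canonical map Sym(I) -> Rees(I), sending [a] to a t. *)
Definition sym_to_rees : sym_alg ideal_module -> rees_alg :=
  sym_lift rees_gen.

Definition linear_type := bijective sym_to_rees.

End Rees.

Record sgraph (T : finType) := SGraph {
  adj :> rel T;
  adj_sym : ssrbool.symmetric adj;
  adj_irrefl : irreflexive adj
}.

Section Graphs.
Variable T : finType.
Implicit Types (G H : sgraph T) (x y : T).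

Definition degree G x := #|[set y | G x y]|.

Definition pendant G x := degree G x == 1%N.

Definition internal G x := (2 <= degree G x)%N.

(* A cycle as a subgraph, i.e. as its set of edges, so that rotating or
   reversing the vertex sequence c gives the same cycle. *)
Definition is_cycle G (C : {set {set T}}) :=
  exists c : seq T, [/\ ucycle G c, (3 <= size c)%N &
    C = [set [set x; next c x] | x in c]].

Definition unicyclic G := exists! C : {set {set T}}, is_cycle G C.

Definition adds_edge H G x y :=
  [/\ x != y, ~~ H x y &
      forall a b, G a b = [|| H a b, (a == x) && (b == y) | (a == y) && (b == x)]].

(* None is the center k_0, and Some (Tagged _ j), with tag i and j : 'I_(s i).+1,
   is the vertex p_(i, j+1). *)
Definition spider_vertex m (s : 'I_m -> nat) := option {i : 'I_m & 'I_(s i).+1}.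

Definition spider_adj m (s : 'I_m -> nat) : rel (spider_vertex s) :=
  fun u v => match u, v with
  | None, None => false
  | None, Some p | Some p, None => tagged p == 0%N :> nat
  | Some p, Some q => (tag p == tag q) &&
      (((tagged p).+1 == tagged q :> nat) || ((tagged q).+1 == tagged p :> nat))
  end.

(* H belongs to the class T_m, with center k0. *)
Definition in_class_T m H (k0 : T) :=
  exists (s : 'I_m -> nat) (f : spider_vertex s -> T),
    [/\ bijective f, f None = k0 & forall u v, H (f u) (f v) = spider_adj u v].

End Graphs.

Section BinomialEdgeIdeal.
Variables (k : fieldType) (n : nat).

Definition xvar (i : 'I_n) : {mpoly k[n + n]} := 'X_(lshift n i).
Definition yvar (i : 'I_n) : {mpoly k[n + n]} := 'X_(rshift n i).

Definition edge_binomial (i j : 'I_n) := xvar i * yvar j - xvar j * yvar i.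

(* One binomial per edge {i, j}, namely f_ij with i < j (f_ji = - f_ij). *)
Definition edge_binomials (G : sgraph 'I_n) : seq {mpoly k[n + n]} :=
  [seq edge_binomial e.1 e.2 | e : 'I_n * 'I_n <- enum {: 'I_n * 'I_n}
                             & (e.1 < e.2)%N && G e.1 e.2].

Definition binomial_edge_ideal (G : sgraph 'I_n) : submodClosed {mpoly k[n + n]}^o :=
  ideal_gen (fun f => exists i j, G i j /\ f = edge_binomial i j).

Definition edge_binomials_form_d_sequence (G : sgraph 'I_n) :=
  exists s, perm_eq s (edge_binomials G) /\ d_sequence s.

End BinomialEdgeIdeal.

(* Main.v *)
Require Import Defs.
From mathcomp Require Import all_boot all_order all_algebra.
From mathcomp Require Import mpoly.
From mathcomp Require Import boolp ring.
From mathcomp Require ring_quotient finmap monalg.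

Set Implicit Arguments.
Unset Strict Implicit.
Unset Printing Implicit Defensive.

Import GRing.Theory.
Local Open Scope ring_scope.

(* In all three cases G is a spider, with center k0, together with a chord from k0
   to another vertex w; in case (b) the two legs are first merged into a single
   leg that runs along one of them and back along the other.  Put
   q = (x_k0, y_k0) and order the edges as follows: the edges inside the legs,
   which form a regular sequence and generate an ideal I0, then the edges from
   k0 to the initial vertices u_1, ..., u_m of the legs, and finally the chord.
   Let J_i be generated by I0 and the first i edges at k0.

   The x_(u_l) form a regular sequence modulo I0, so a syzygy computation shows
   that x_k0 is a nonzerodivisor on q modulo J_i.  It therefore suffices to
   argue after inverting x_k0, and there a linear change of coordinates turns the
   edge binomial f_(k0,v) into y_v and J_i into I0 + (y_(u_1), ..., y_(u_i)).
   Now y_(u_(i+1)) is a nonzerodivisor modulo this ideal, which settles the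
   edges at k0, and for i = m the ideal is radical, which settles the chord.

   A d-sequence a generates an ideal of linear type: if a form of degree d in
   the symmetric algebra has its value in (a_1, ..., a_i), then it lies in the
   ideal of the first i generators of the symmetric algebra.  This goes by
   induction on d and descending induction on i, using
   ((a_1, ..., a_i) : a_(i+1)) /\ (a) = (a_1, ..., a_i); take i = 0. *)

(** * Ideals and nonzerodivisors *)

Section IdealSeq.
Variable R : comNzRingType.
Implicit Types (s : seq R) (a b c z : R).

Lemma ideal0 s : 0 \in ideal_seq s.
Proof. exact: rpred0. Qed.

Lemma idealD s a b : a \in ideal_seq s -> b \in ideal_seq s -> a + b \in ideal_seq s.
Proof. exact: rpredD. Qed.

Lemma idealMl s c a : a \in ideal_seq s -> c * a \in ideal_seq s.
Proof. by move=> ?; apply: (rpredZ c). Qed.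

Lemma idealMr s c a : a \in ideal_seq s -> a * c \in ideal_seq s.
Proof. by rewrite mulrC; apply: idealMl. Qed.

Lemma idealN s a : a \in ideal_seq s -> - a \in ideal_seq s.
Proof. by rewrite -mulN1r; apply: idealMl. Qed.

Lemma idealB s a b : a \in ideal_seq s -> b \in ideal_seq s -> a - b \in ideal_seq s.
Proof. by move=> ha hb; apply/idealD/idealN. Qed.

Lemma ideal_sum s (I : Type) (r : seq I) (P : pred I) (F : I -> R) :
  (forall i, P i -> F i \in ideal_seq s) -> \sum_(i <- r | P i) F i \in ideal_seq s.
Proof.
by move=> h; elim/big_ind: _ => //; [exact: ideal0|move=> *; exact: idealD].
Qed.

Lemma ideal_mem s a : a \in s -> a \in ideal_seq s.
Proof. exact: (@ideal_gen_sub _ (fun x => x \in s)). Qed.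

Lemma ideal_seqP (P : R -> Prop) s :
  P 0 -> (forall a b, P a -> P b -> P (a + b)) -> (forall c a, P a -> P (c * a)) ->
  {in s, forall a, P a} -> {in ideal_seq s, forall z, P z}.
Proof.
move=> P0 PD PM Ps z /asboolP[t ts ->]; rewrite big_seq.
by elim/big_ind: _ => // u /ts us; apply/PM/Ps.
Qed.

Lemma ideal_subset s (t : seq R) : {in s, forall a, a \in ideal_seq t} ->
  {subset ideal_seq s <= ideal_seq t}.
Proof.
by apply: ideal_seqP => [|a b|c a]; [exact: ideal0|exact: idealD|exact: idealMl].
Qed.

Lemma ideal_sub_mem s (t : seq R) : {subset s <= t} -> {subset ideal_seq s <= ideal_seq t}.
Proof. by move=> h; apply: ideal_subset => a /h; apply: ideal_mem. Qed.

Lemma ideal_cons a s z : z \in ideal_seq s -> z \in ideal_seq (a :: s).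
Proof. by apply: ideal_sub_mem => u us; rewrite in_cons us orbT. Qed.

Lemma ideal_catl s (t : seq R) z : z \in ideal_seq s -> z \in ideal_seq (s ++ t).
Proof. by apply: ideal_sub_mem => u us; rewrite mem_cat us. Qed.

Lemma eq_ideal_mem s (t : seq R) : s =i t -> ideal_seq s =i ideal_seq t.
Proof. by move=> h z; apply/idP/idP; apply: ideal_sub_mem => a; rewrite h. Qed.

Lemma ideal_consP a s z :
  reflect (exists c, z - c * a \in ideal_seq s) (z \in ideal_seq (a :: s)).
Proof.
apply: (iffP idP) => [|[c hc]].
  move: z; apply: ideal_seqP.
  - by exists 0; rewrite mul0r subr0 ideal0.
  - move=> u v [c hc] [d hd]; exists (c + d).
    by rewrite mulrDl opprD addrACA idealD.
  - by move=> c u [d hd]; exists (c * d); rewrite -mulrA -mulrBr idealMl.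
  - move=> u; rewrite inE => /orP[/eqP->|us].
      by exists 1; rewrite mul1r subrr ideal0.
    by exists 0; rewrite mul0r subr0 ideal_mem.
rewrite -(subrK (c * a) z); apply: idealD; last first.
  by apply/idealMl/ideal_mem; rewrite mem_head.
exact: ideal_cons.
Qed.

Lemma ideal_cat_mapP (I : eqType) (F : I -> R) s (r : seq I) z : uniq r ->
  reflect (exists h : I -> R, z - \sum_(i <- r) h i * F i \in ideal_seq s)
    (z \in ideal_seq (s ++ map F r)).
Proof.
move=> ur; apply: (iffP idP) => [|[h hz]]; last first.
  rewrite -(subrK (\sum_(i <- r) h i * F i) z); apply: idealD.
    exact: ideal_catl.
  rewrite big_seq; apply: ideal_sum => i ir; apply/idealMl/ideal_mem.
  by rewrite mem_cat map_f ?orbT.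
move: z; apply: ideal_seqP.
- by exists (fun=> 0); rewrite big1 ?subr0 ?ideal0 // => i; rewrite mul0r.
- move=> u v [h hu] [g gv]; exists (fun i => h i + g i).
  under eq_bigr do rewrite mulrDl.
  by rewrite big_split /= opprD addrACA idealD.
- move=> c u [h hu]; exists (fun i => c * h i).
  under eq_bigr do rewrite -mulrA.
  by rewrite -mulr_sumr -mulrBr idealMl.
move=> a; rewrite mem_cat => /orP[ha|/mapP[i ir ->]].
  by exists (fun=> 0); rewrite big1 ?subr0 ?ideal_mem // => i; rewrite mul0r.
exists (fun j => (j == i)%:R); rewrite (bigD1_seq i) //= eqxx mul1r big1 ?addr0.
  by rewrite subrr ideal0.
by move=> j /negPf ->; rewrite mul0r.
Qed.

Lemma ideal_morph (R' : comNzRingType) (phi : {rmorphism R -> R'}) s (t : seq R') :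
  {in s, forall a, phi a \in ideal_seq t} ->
  {in ideal_seq s, forall z, phi z \in ideal_seq t}.
Proof.
move=> hs; apply: ideal_seqP => // [|a b ha hb|c a ha].
- by rewrite rmorph0 rpred0.
- by rewrite rmorphD rpredD.
- by rewrite rmorphM; apply: (rpredZ (phi c)).
Qed.

Definition nzd a s := forall z, a * z \in ideal_seq s -> z \in ideal_seq s.

(** Testing squares suffices: if a power of [z] lies in the ideal, so does one whose exponent is a
    power of 2, and that exponent can be halved repeatedly. *)
Definition radical_seq s := forall z, z * z \in ideal_seq s -> z \in ideal_seq s.

Lemma eq_nzd a s (t : seq R) : ideal_seq s =i ideal_seq t -> nzd a s -> nzd a t.
Proof. by move=> e h z; rewrite -!e; apply: h. Qed.

Lemma eq_radical s (t : seq R) : ideal_seq s =i ideal_seq t -> radical_seq s -> radical_seq t.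
Proof. by move=> e h z; rewrite -!e; apply: h. Qed.

Lemma nzdX a s m : nzd a s -> nzd (a ^+ m) s.
Proof.
move=> h; elim: m => [|m IH] z; first by rewrite mul1r.
by rewrite exprS -mulrA => /h/IH.
Qed.

(* R is a polynomial ring in the variable t, and phi substitutes 0 for t. *)
Definition kills (phi : {rmorphism R -> R}) t :=
  [/\ phi t = 0, forall z, exists h, z = phi z + t * h &
      forall h, t * h = 0 -> h = 0].

Definition fixes (phi : {rmorphism R -> R}) s := {in s, forall a, phi a = a}.

(** The ideal is closed in the [t]-adic topology. *)
Definition separated s t :=
  forall z, (forall m, exists c, z - t ^+ m * c \in ideal_seq s) -> z \in ideal_seq s.

(** * Ideals whose generators do not involve a given variable *)

Section Fresh.
Variables (phi : {rmorphism R -> R}) (t : R).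
Hypothesis kt : kills phi t.

Lemma ideal_fixes s z : fixes phi s -> z \in ideal_seq s -> phi z \in ideal_seq s.
Proof. by move=> fs; apply: ideal_morph z => a sa; rewrite fs ?ideal_mem. Qed.

(** Dividing every multiplier by [t] with remainder divides the whole combination, because [phi]
    fixes the generators; so the quotient [h] stays in the ideal. *)
Lemma ideal_kills s z : fixes phi s -> z \in ideal_seq s ->
  exists2 h, h \in ideal_seq s & z = phi z + t * h.
Proof.
have [_ div _] := kt; move=> fs zs.
suff [_ [h [hs e]]] : phi z \in ideal_seq s /\
    exists h, h \in ideal_seq s /\ z = phi z + t * h by exists h.
move: z zs; apply: ideal_seqP.
- split; first by rewrite rmorph0 ideal0.
  by exists 0; rewrite ideal0 rmorph0 mulr0 addr0.
- move=> a b [pa [h [hs ea]]] [pb [g [gs eb]]]; rewrite rmorphD.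
  split; first exact: idealD.
  by exists (h + g); rewrite idealD //; split=> //; rewrite {1}ea {1}eb; ring.
- move=> c a [pa [h [hs ea]]]; have [g ec] := div c; rewrite rmorphM.
  split; first exact: idealMl.
  exists (g * phi a + c * h); rewrite idealD ?idealMl //; split=> //.
  by rewrite {1}ea mulrDr {1}ec; ring.
- move=> a sa; rewrite fs // ideal_mem //; split=> //.
  by exists 0; rewrite ideal0 mulr0 addr0.
Qed.

Lemma kills_nzd s : fixes phi s -> nzd t s.
Proof.
have [pt _ reg] := kt; move=> fs z /(ideal_kills fs)[h hs].
rewrite rmorphM pt mul0r add0r => /eqP; rewrite -subr_eq0 -mulrBr => /eqP/reg.
by move/eqP; rewrite subr_eq0 => /eqP ->.
Qed.

Lemma kills_radical s : fixes phi s -> radical_seq s -> radical_seq (t :: s).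
Proof.
have [pt div _] := kt; move=> fs rs z zz; have [h ez] := div z.
apply/ideal_consP; exists h; rewrite {1}ez mulrC addrK; apply: rs; rewrite -rmorphM.
case/ideal_consP: zz => c /(ideal_fixes fs).
by rewrite rmorphB [phi (c * t)]rmorphM pt mulr0 subr0.
Qed.

End Fresh.

(* One step of building a path: a new vertex with coordinates (s, t) is joined
   by an edge to a vertex with coordinates (A, B). *)
Section Pendant.
Variables (phi psi : {rmorphism R -> R}) (s t A B : R) (L : seq R).
Hypotheses (ks : kills phi s) (kt : kills psi t) (phit : phi t = t).
Hypotheses (phiA : phi A = A) (psiA : psi A = A) (phiB : phi B = B).
Hypotheses (phiL : fixes phi L) (psiL : fixes psi L).
Let b := A * t - B * s.

(** Let [s * z] be [c * b] modulo [L]. Setting [s] to 0 turns [b] into [A * t], a nonzerodivisor, so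
    [phi c] lies in the ideal of [L]; thus [c] is a multiple of [s] modulo [L], and [s] cancels. *)
Lemma pendant_vertex_nzd : nzd A L -> nzd s (b :: L).
Proof.
have [ps div _] := ks; move=> nA z /ideal_consP[c hc].
have phib : phi b = A * t by rewrite rmorphB !rmorphM phiA phit ps; ring.
have pc : phi c \in ideal_seq L.
  apply: (kills_nzd kt psiL); apply: nA.
  have := ideal_fixes phiL hc; rewrite rmorphB !rmorphM phib ps mul0r sub0r.
  by move/idealN; rewrite opprK mulrC -mulrA [t * _]mulrC mulrC -mulrA mulrCA.
have [h ec] := div c; apply/ideal_consP; exists h.
apply: (kills_nzd ks phiL).
rewrite (_ : s * _ = (s * z - c * b) + phi c * b); last first.
  by rewrite {1}ec; ring.
exact/idealD/idealMr.
Qed.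

(** If [b * z] lies in the ideal, setting [s] to 0 shows that [z] is [s * h] modulo it, and [b * h]
    lies in it again. Iterating makes [z] divisible by every power of [s] modulo [L]. *)
Lemma pendant_edge_nzd : separated L s -> nzd A L -> nzd b L.
Proof.
have [ps div _] := ks; move=> sep nA z hz; apply: sep => m.
suff [c bc hc] : exists2 c, b * c \in ideal_seq L & z - s ^+ m * c \in ideal_seq L.
  by exists c.
have phib : phi b = A * t by rewrite rmorphB !rmorphM phiA phit ps; ring.
elim: m => [|m [c bc hc]]; first by exists z => //; rewrite mul1r subrr ideal0.
have pc : phi c \in ideal_seq L.
  apply: (kills_nzd kt psiL); apply: nA.
  by rewrite mulrA -phib -rmorphM ideal_fixes.
have [h ec] := div c; exists h.
  apply: (kills_nzd ks phiL).
  rewrite (_ : s * _ = b * c - b * phi c); last by rewrite {1}ec; ring.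
  exact/idealB/idealMl.
rewrite (_ : z - _ = z - s ^+ m * c + s ^+ m * phi c).
  by rewrite idealD // idealMl.
by rewrite {1}ec exprS; ring.
Qed.

(** Modulo [s] the binomial [b] becomes [A * t]. If the square of [z = psi z + t * h] lies in the
    ideal of [A * t :: L], setting [t] to 0 puts [psi z] in the ideal of [L]; cancelling [t] twice
    then puts [h * h], hence [h], in the ideal of [A :: L]. *)
Lemma pendant_vertex_radical :
  radical_seq L -> radical_seq (A :: L) -> radical_seq (s :: b :: L).
Proof.
have [ps divs _] := ks; have [pt divt _] := kt; move=> rL rA.
have eI : ideal_seq (s :: b :: L) =i ideal_seq (s :: A * t :: L).
  move=> z; apply/idP/idP; apply: ideal_subset => a; rewrite !inE => /or3P[/eqP->|/eqP->|aL].
  - by rewrite ideal_mem ?mem_head.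
  - by apply/idealB/idealMl; apply: ideal_mem; rewrite !inE eqxx ?orbT.
  - by rewrite ideal_mem // !inE aL !orbT.
  - by rewrite ideal_mem ?mem_head.
  - rewrite (_ : A * t = b + B * s); last by rewrite /b; ring.
    by apply/idealD/idealMl; apply: ideal_mem; rewrite !inE eqxx ?orbT.
  - by rewrite ideal_mem // !inE aL !orbT.
apply: (eq_radical (fun z => esym (eI z))); apply: (kills_radical ks).
  by move=> a; rewrite inE => /orP[/eqP->|/phiL //]; rewrite rmorphM phiA phit.
have psiAt c : psi (c * (A * t)) = 0 by rewrite !rmorphM pt !mulr0.
move=> z zz; have [h ez] := divt z.
have p2 : psi z \in ideal_seq L.
  apply: rL; rewrite -rmorphM; case/ideal_consP: zz => c /(ideal_fixes psiL).
  by rewrite rmorphB psiAt subr0.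
have hA : h \in ideal_seq (A :: L).
  apply: rA; apply: (kills_nzd kt).
    by move=> a; rewrite inE => /orP[/eqP->|/psiL].
  case/ideal_consP: zz => c hc; apply/ideal_consP; exists c.
  apply: (kills_nzd kt psiL).
  rewrite (_ : t * _ = z * z - c * (A * t) - psi z * (z + t * h)).
    exact/idealB/idealMr.
  by rewrite {1 2 4}ez; ring.
rewrite ez; apply: idealD.
  exact: ideal_cons.
case/ideal_consP: hA => c hc; apply/ideal_consP; exists c.
by rewrite (_ : _ - _ = t * (h - c * A)); [exact: idealMl|ring].
Qed.

(** By radicality after adding [s], any [z] with square in the ideal is [h * s] modulo it. As [s] is
    a nonzerodivisor, [h * h] lies in the ideal too, so the division by [s] can be repeated and
    separatedness applies. *)
Lemma pendant_radical : separated (b :: L) s -> nzd A L ->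
  radical_seq L -> radical_seq (A :: L) -> radical_seq (b :: L).
Proof.
move=> sep nA rL rA z zz; apply: sep => m.
suff [c cc hc] : exists2 c, c * c \in ideal_seq (b :: L) &
    z - s ^+ m * c \in ideal_seq (b :: L) by exists c.
have ns := pendant_vertex_nzd nA.
elim: m => [|m [c cc hc]]; first by exists z => //; rewrite mul1r subrr ideal0.
have /ideal_consP[h hh] : c \in ideal_seq (s :: b :: L).
  apply: pendant_vertex_radical => //.
  exact: ideal_cons.
exists h.
  apply: (nzdX (m := 2) ns).
  rewrite (_ : s ^+ 2 * _ = c * c - (c - h * s) * (c + h * s)); last by ring.
  exact/idealB/idealMr.
rewrite (_ : z - _ = z - s ^+ m * c + s ^+ m * (c - h * s)).
  exact/idealD/idealMl.
by rewrite exprS; ring.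
Qed.

End Pendant.
End IdealSeq.

(** * Disjoint paths *)

(** The edge at [u] comes last: a path is built from its far end, each edge attaching one new vertex
    to the part already treated. *)
Fixpoint path_edges (V : Type) (u : V) (l : seq V) : seq (V * V) :=
  if l is v :: l' then rcons (path_edges v l') (u, v) else [::].

(* A leg (u, l) is the path u :: l, listed from its end u near the center. *)
Definition leg_edges (V : Type) (ls : seq (V * seq V)) : seq (V * V) :=
  flatten [seq path_edges e.1 e.2 | e <- ls].

Definition leg_vertices (V : Type) (ls : seq (V * seq V)) : seq V :=
  flatten [seq e.1 :: e.2 | e <- ls].

Lemma path_edges_sub (V : eqType) (u : V) l e : e \in path_edges u l ->
  e.1 \in u :: l /\ e.2 \in u :: l.
Proof.
elim: l u => [|v l IH] u //=; rewrite mem_rcons inE => /orP[/eqP->|/IH[h1 h2]].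
  by rewrite /= !inE !eqxx orbT.
by rewrite ![_ \in u :: _]in_cons h1 h2 !orbT.
Qed.

Lemma leg_edges_sub (V : eqType) (ls : seq (V * seq V)) e : e \in leg_edges ls ->
  e.1 \in leg_vertices ls /\ e.2 \in leg_vertices ls.
Proof.
case/flattenP=> _ /mapP[d dls ->] /path_edges_sub[h1 h2].
by split; apply/flattenP; exists (d.1 :: d.2) => //; apply: map_f.
Qed.

Section Legs.
Variables (V : eqType) (R : comNzRingType) (p q : V -> R).
Variables (kp kq : V -> {rmorphism R -> R}) (graded : R -> Prop).

(** The 2-minors of the matrix with rows [p] and [q]. The rows stay abstract because the results are
    used for [x], [y] and also with the two exchanged. *)
Definition minor (e : V * V) := p e.1 * q e.2 - p e.2 * q e.1.

Hypotheses (kpP : forall v, kills (kp v) (p v)) (kqP : forall v, kills (kq v) (q v)).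
Hypotheses (kp_p : forall u v, u != v -> kp v (p u) = p u).
Hypotheses (kq_q : forall u v, u != v -> kq v (q u) = q u).
Hypotheses (kp_q : forall u v, kp v (q u) = q u).
Hypotheses (kq_p : forall u v, kq v (p u) = p u).
Hypotheses (graded_p : forall v, graded (p v)) (graded_minor : forall e, graded (minor e)).
Hypothesis sep : forall L v, {in L, forall a, graded a} -> separated L (p v).

Implicit Types (L : seq R) (ls : seq (V * seq V)).

Definition free v L := fixes (kp v) L /\ fixes (kq v) L.

Lemma free_cat v L L' : free v L -> free v L' -> free v (L ++ L').
Proof.
move=> [h1 h2] [h3 h4]; split=> a; rewrite mem_cat => /orP[];
  by [apply: h1|apply: h3|apply: h2|apply: h4].
Qed.

Lemma free_minors v s : (forall e, e \in s -> e.1 != v /\ e.2 != v) ->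
  free v (map minor s).
Proof.
move=> h; split=> _ /mapP[e /h[e1 e2] ->];
  by rewrite /minor rmorphB !rmorphM ?kp_q ?kq_p ?kp_p ?kq_q.
Qed.

Lemma free_path v u l : v \notin u :: l -> free v (map minor (path_edges u l)).
Proof.
move=> vl; apply: free_minors => e /path_edges_sub[h1 h2].
by split; apply: contraNneq vl => <-.
Qed.

Lemma free_legs v ls : v \notin leg_vertices ls -> free v (map minor (leg_edges ls)).
Proof.
move=> vl; apply: free_minors => e /leg_edges_sub[h1 h2].
by split; apply: contraNneq vl => <-.
Qed.

Lemma free_map_p v us : v \notin us -> free v (map p us).
Proof.
move=> vu; split=> _ /mapP[w wu ->]; rewrite ?kq_p // kp_p //.
by apply: contraNneq vu => <-.
Qed.

Lemma graded_cat_minors L s : {in L, forall a, graded a} ->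
  {in L ++ map minor s, forall a, graded a}.
Proof. by move=> hL a; rewrite mem_cat => /orP[/hL //|/mapP[e _ ->]]. Qed.

Section OneLeg.
Variables (L : seq R).
Hypothesis hL : {in L, forall a, graded a}.

(** Up to sign and position, the new edge is the binomial [A * t - B * s] of the pendant step, with
    [A], [B] the coordinates of the old vertex [v] and [s], [t] those of the new vertex [u]. *)
Lemma edge_eq L' u v :
  ideal_seq ((p v * q u - q v * p u) :: L') =i ideal_seq (rcons L' (minor (u, v))).
Proof.
have e : minor (u, v) = - (p v * q u - q v * p u) by rewrite /minor /=; ring.
move=> z; apply/idP/idP; apply: ideal_subset => a.
  rewrite inE => /orP[/eqP->|aL].
    by rewrite -[X in X \in _]opprK -e; apply/idealN/ideal_mem; rewrite mem_rcons mem_head.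
  by apply: ideal_mem; rewrite mem_rcons in_cons aL orbT.
rewrite mem_rcons inE => /orP[/eqP->|aL].
  by rewrite e; apply/idealN/ideal_mem; rewrite mem_head.
by apply: ideal_mem; rewrite in_cons aL orbT.
Qed.

Definition free_all u l := forall v, v \in u :: l -> free v L.

Lemma free_all_tail u v l : free_all u (v :: l) -> free_all v l.
Proof. by move=> fL w wl; apply: fL; rewrite in_cons wl orbT. Qed.

(** Induction from the far end, where the coordinate is a fresh variable; [pendant_vertex_nzd]
    passes the property from [v] to the new vertex [u]. *)
Lemma path_head_nzd u l : uniq (u :: l) -> free_all u l ->
  nzd (p u) (L ++ map minor (path_edges u l)).
Proof.
elim: l u => [|v l IH] u ul fL /=.
  by rewrite cats0; apply: (kills_nzd (kpP u)); case: (fL u (mem_head _ _)).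
have [uv vl] := andP ul; rewrite map_rcons -rcons_cat.
apply: eq_nzd (edge_eq _ _ _) _.
have [f1 f2] := free_cat (fL u (mem_head _ _)) (free_path uv).
have vu : v != u by apply: contraNneq uv => <-; exact: mem_head.
apply: (pendant_vertex_nzd (phi := kp u) (psi := kq u)); rewrite ?kp_p ?kp_q ?kq_p //.
by apply: IH => //; apply: free_all_tail fL.
Qed.

(** The last edge in the list is a pendant edge at [v], and [p v] is a nonzerodivisor by
    [path_head_nzd]; the other edges belong to the shorter path. *)
Lemma path_edge_nzd u l i : uniq (u :: l) -> free_all u l ->
  (i < size (path_edges u l))%N ->
  nzd (map minor (path_edges u l))`_i (L ++ take i (map minor (path_edges u l))).
Proof.
elim: l u => [|v l IH] u //= ul fL.
have [uv vl] := andP ul; rewrite map_rcons size_rcons ltnS.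
rewrite leq_eqVlt nth_rcons -cats1 size_map => /orP[/eqP->|il].
  rewrite ltnn eqxx take_size_cat ?size_map // => z hz.
  have [f1 f2] := free_cat (fL u (mem_head _ _)) (free_path uv).
  have vu : v != u by apply: contraNneq uv => <-; exact: mem_head.
  have h : nzd (p v * q u - q v * p u) (L ++ map minor (path_edges v l)).
    apply: (pendant_edge_nzd (phi := kp u) (psi := kq u)); rewrite ?kp_p ?kp_q ?kq_p //.
      exact/sep/graded_cat_minors.
    by apply: path_head_nzd => //; apply: free_all_tail fL.
  apply: h; rewrite (_ : _ * z = - (minor (u, v) * z)); first exact: idealN.
  by rewrite /minor /=; ring.
rewrite il take_cat size_map il; apply: IH => //; exact: free_all_tail fL.
Qed.

(** Both claims need a single induction, since attaching a vertex requires radicality of the old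
    ideal with and without [p v]. *)
Lemma path_radical u l : uniq (u :: l) -> free_all u l -> radical_seq L ->
  radical_seq (L ++ map minor (path_edges u l)) /\
  radical_seq (p u :: (L ++ map minor (path_edges u l))).
Proof.
elim: l u => [|v l IH] u ul fL rL /=.
  by rewrite cats0; split=> //; apply: kills_radical (kpP u) _ _ _; case: (fL u (mem_head _ _)).
have [uv vl] := andP ul; rewrite map_rcons -rcons_cat.
have [f1 f2] := free_cat (fL u (mem_head _ _)) (free_path uv).
have vu : v != u by apply: contraNneq uv => <-; exact: mem_head.
have fl := free_all_tail fL; have [r1 r2] := IH v vl fl rL.
have nv := path_head_nzd vl fl; split.
  apply: eq_radical (edge_eq _ _ _) _.
  apply: (pendant_radical (phi := kp u) (psi := kq u)); rewrite ?kp_p ?kp_q ?kq_p //.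
  apply: sep => a; rewrite inE => /orP[/eqP->|]; last exact: graded_cat_minors.
  rewrite (_ : _ - _ = minor (v, u)); first exact: graded_minor.
  by rewrite /minor /=; ring.
set L' := L ++ _ in f1 f2 r1 r2 nv *.
apply: (@eq_radical _ (p u :: (p v * q u - q v * p u) :: L')).
  move=> z; apply/ideal_consP/ideal_consP => -[c hc]; exists c; move: hc;
    by rewrite edge_eq.
by apply: (pendant_vertex_radical (phi := kp u) (psi := kq u)); rewrite ?kp_p ?kp_q ?kq_p.
Qed.

End OneLeg.

Lemma leg_vertices_cons e ls : leg_vertices (e :: ls) = e.1 :: e.2 ++ leg_vertices ls.
Proof. by []. Qed.

Lemma free_leg_tail L e ls : uniq (leg_vertices (e :: ls)) ->
  (forall v, v \in leg_vertices (e :: ls) -> free v L) ->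
  forall v, v \in leg_vertices ls -> free v (L ++ map minor (path_edges e.1 e.2)).
Proof.
rewrite leg_vertices_cons -cat_cons cat_uniq => /and3P[_ /hasPn dj _] fL v vl.
by apply: free_cat; [apply: fL; rewrite mem_cat vl orbT|apply/free_path/dj].
Qed.

(** The edges of a finished leg move into [L], as they involve no vertex of the remaining legs. *)
Lemma leg_edge_nzd L ls i : {in L, forall a, graded a} -> uniq (leg_vertices ls) ->
  (forall v, v \in leg_vertices ls -> free v L) ->
  (i < size (leg_edges ls))%N ->
  nzd (map minor (leg_edges ls))`_i (L ++ take i (map minor (leg_edges ls))).
Proof.
elim: ls L i => [|e ls IH] L i hL uls fL //.
rewrite /leg_edges /= -/(leg_edges ls) size_cat map_cat => il.
have := uls; rewrite leg_vertices_cons -cat_cons cat_uniq => /and3P[ue _ ul].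
rewrite nth_cat take_cat size_map; case: ltnP => ie.
  apply: path_edge_nzd => // v ve; apply: fL.
  by rewrite leg_vertices_cons -cat_cons mem_cat ve.
rewrite catA; apply: IH => //; first exact: graded_cat_minors.
- exact: free_leg_tail.
- by rewrite ltn_subLR.
Qed.

Lemma leg_heads_radical L ls : {in L, forall a, graded a} -> uniq (leg_vertices ls) ->
  (forall v, v \in leg_vertices ls -> free v L) -> radical_seq L ->
  radical_seq (L ++ map minor (leg_edges ls) ++ map p (map fst ls)).
Proof.
elim: ls L => [|e ls IH] L hL uls fL rL; first by rewrite cats0.
have := uls; rewrite leg_vertices_cons -cat_cons cat_uniq => /and3P[ue /hasPn dj ul].
have fe : free_all L e.1 e.2.
  by move=> v ve; apply: fL; rewrite leg_vertices_cons -cat_cons mem_cat ve.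
have [_ r] := path_radical hL ue fe rL.
apply: eq_radical (IH (p e.1 :: (L ++ map minor (path_edges e.1 e.2))) _ _ _ _) => //.
- apply: eq_ideal_mem => a; rewrite /leg_edges /= map_cat !(in_cons, mem_cat).
  by do ![case: (_ \in _)]; rewrite ?orbT ?orbF.
- by move=> a; rewrite inE => /orP[/eqP->|] //; apply: graded_cat_minors.
move=> v vl; apply: (free_cat (L := [:: p e.1])); last exact: free_leg_tail vl.
apply: (free_map_p (us := [:: e.1])); rewrite inE.
by apply: contraNneq (dj v vl) => ->; exact: mem_head.
Qed.

(** The leg of [u] can be treated last: the other edges and the variables of [us] avoid its vertices
    and serve as the base ideal of [path_head_nzd]. *)
Lemma leg_head_nzd ls1 ls2 u l us : uniq (leg_vertices (ls1 ++ (u, l) :: ls2)) ->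
  {in us, forall w, w \notin u :: l} ->
  nzd (p u) (map minor (leg_edges (ls1 ++ (u, l) :: ls2)) ++ map p us).
Proof.
move=> uls dus.
have pl : perm_eq (leg_vertices (ls1 ++ (u, l) :: ls2))
                  (leg_vertices ((u, l) :: (ls1 ++ ls2))).
  by apply: perm_flatten; apply: perm_map;
     exact: (permEl (perm_catCA ls1 [:: (u, l)] ls2)).
have := uls; rewrite (perm_uniq pl) leg_vertices_cons -cat_cons cat_uniq.
case/and3P=> ul /hasPn dj _.
have := @path_head_nzd (map minor (leg_edges (ls1 ++ ls2)) ++ map p us) u l ul.
move=> h; apply: eq_nzd (h _).
  apply: eq_ideal_mem => a; rewrite /leg_edges !map_cat !flatten_cat /=.
  rewrite !map_cat !mem_cat.
  by do ![case: (_ \in _)]; rewrite ?orbT ?orbF.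
move=> v vl; apply: free_cat.
  by apply: free_legs; apply: contraL vl => /dj.
by apply: free_map_p; apply: contraL vl => /dus.
Qed.

End Legs.

(** * Substitutions and homogeneous components *)

Section Substitution.
Variables (k : fieldType) (N : nat).
Implicit Types (i : 'I_N) (z a c : {mpoly k[N]}) (L : seq {mpoly k[N]}).

Lemma mpoly_ring_ind (P : {mpoly k[N]} -> Prop) :
  (forall c : k, P c%:MP) -> (forall i, P 'X_i) ->
  (forall y z, P y -> P z -> P (y + z)) -> (forall y z, P y -> P z -> P (y * z)) ->
  forall z, P z.
Proof.
move=> PC PX PD PM z; rewrite [z]mpolyE.
elim/big_ind: _ => [||m _]; [exact: (PC 0)|exact: PD|].
rewrite -mul_mpolyC; apply: (PM) => //; rewrite mpolyXE_id.
elim/big_ind: _ => [||i _]; [exact: (PC 1)|exact: PM|].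
by elim: (m i) => [|j IH]; [exact: (PC 1)|rewrite exprS; apply: (PM)].
Qed.

Lemma morph_comp_ext (f g h : {rmorphism {mpoly k[N]} -> {mpoly k[N]}}) :
  (forall c : k, f (g c%:MP) = h c%:MP) -> (forall i, f (g 'X_i) = h 'X_i) ->
  forall z, f (g z) = h z.
Proof.
move=> fC fX; apply: mpoly_ring_ind => [c|i|y z ey ez|y z ey ez] //.
  by rewrite !rmorphD ey ez.
by rewrite !rmorphM ey ez.
Qed.

(* Sealed by [Qed], since unfolding [mmap] makes unification very slow. *)
Lemma subst_exists (h : 'I_N -> {mpoly k[N]}) :
  {phi : {rmorphism {mpoly k[N]} -> {mpoly k[N]}} |
    (forall i, phi 'X_i = h i) /\ (forall c : k, phi c%:MP = c%:MP)}.
Proof.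
exists (mmap (@mpolyC N k) h : {rmorphism _ -> _}).
by split=> [i|c] /=; [rewrite mmapX mmap1U|rewrite mmapC].
Qed.

Definition subst h := sval (subst_exists h).

Lemma substX h i : subst h 'X_i = h i.
Proof. exact: (svalP (subst_exists h)).1. Qed.

Lemma substC h (c : k) : subst h c%:MP = c%:MP.
Proof. exact: (svalP (subst_exists h)).2. Qed.

Definition kill i := subst (fun j => if j == i then 0 else 'X_j).

Lemma killX i j : kill i 'X_j = if j == i then 0 else 'X_j.
Proof. exact: substX. Qed.

Lemma killP i : kills (kill i) 'X_i.
Proof.
split=> [|z|h /eqP]; first by rewrite killX eqxx.
  elim/mpoly_ring_ind: z => [c|j|y z [h eh] [g eg]|y z [h eh] [g eg]].
  - by exists 0; rewrite substC mulr0 addr0.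
  - rewrite killX; case: eqP => [->|_]; first by exists 1; rewrite mulr1 add0r.
    by exists 0; rewrite mulr0 addr0.
  - by exists (h + g); rewrite rmorphD {1}eh {1}eg; ring.
  - exists (h * z + kill i y * g); rewrite rmorphM {1}eh mulrDl {1}eg.
    by ring.
by rewrite mulf_eq0 => /orP[|/eqP //]; rewrite -msupp_eq0 msuppX.
Qed.

(** * Homogeneous components and separatedness *)

Definition homogeneous a := exists d, a \is d.-homog for (@mdeg N).

(** Multiplication by [a] raises degrees by exactly [d]; the test guards the truncated
    subtraction. *)
Lemma pihomogM d e c a : a \is d.-homog for (@mdeg N) ->
  pihomog (@mdeg N) e (c * a) =
  if (d <= e)%N then pihomog (@mdeg N) (e - d) c * a else 0.
Proof.
move=> ha.
have [K cK] : exists K, c = \sum_(j < K) pihomog (@mdeg N) j c.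
  by exists (mmeasure (@mdeg N) c); apply: pihomog_partitionE.
rewrite {1}cK mulr_suml raddf_sum /=.
have hj j : pihomog (@mdeg N) j c * a \is (j + d).-homog for (@mdeg N).
  by apply: dhomogM => //; apply: pihomogP.
case: leqP => de; last first.
  rewrite big1 // => j _; apply: (pihomog_ne0 _ (hj j)).
  by rewrite gtn_eqF // (leq_trans de) // leq_addl.
rewrite cK raddf_sum mulr_suml /=; apply: eq_bigr => j _; rewrite -cK.
have [ej|nej] := eqVneq (j + d)%N e.
  by rewrite -ej addnK pihomog_id pihomog_dE.
rewrite (pihomog_ne0 nej) // (pihomog_ne0 _ (pihomogP _ _ _)) ?mul0r //.
by apply: contraNneq nej => ->; rewrite subnK.
Qed.

Lemma ideal_pihomog L d z : {in L, forall a, homogeneous a} ->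
  z \in ideal_seq L -> pihomog (@mdeg N) d z \in ideal_seq L.
Proof.
move=> hL /asboolP[t tL ->]; rewrite raddf_sum big_seq.
apply: ideal_sum => u /tL uL /=; have [e he] := hL _ uL.
by rewrite (pihomogM _ _ he); case: ifP => _; [apply/idealMl/ideal_mem|exact: ideal0].
Qed.

Lemma ideal_homog_parts L z :
  (forall d, pihomog (@mdeg N) d z \in ideal_seq L) -> z \in ideal_seq L.
Proof.
move=> h; rewrite (pihomog_partitionE (leqnn (mmeasure (@mdeg N) z))).
by apply: ideal_sum.
Qed.

Lemma homogeneousX i : ('X_i : {mpoly k[N]}) \is 1.-homog for (@mdeg N).
Proof. by rewrite dhomogX /= mdeg1. Qed.

(** The component of degree [d] of ['X_i ^+ d.+1 * c] vanishes, so every component of [z] lies in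
    the ideal. *)
Lemma homogeneous_separated L i : {in L, forall a, homogeneous a} -> separated L 'X_i.
Proof.
move=> hL z hz; apply: ideal_homog_parts => d; have [c hc] := hz d.+1.
have := ideal_pihomog d hL hc; rewrite raddfB /= mulrC.
rewrite (@pihomogM d.+1) ?ltnn ?subr0 //.
by have := dhomogMn d.+1 (homogeneousX i); rewrite mul1n.
Qed.

Lemma homog_subst_scale (h : 'I_N -> {mpoly k[N]}) a d z :
  (forall i, h i = a * 'X_i) -> z \is d.-homog for (@mdeg N) ->
  subst h z = a ^+ d * z.
Proof.
move=> ha hz; rewrite [z in RHS]mpolyE [z in LHS]mpolyE mulr_sumr rmorph_sum big_seq [RHS]big_seq.
apply: eq_bigr => m mz; rewrite -mul_mpolyC rmorphM substC mulrCA; congr (_ * _).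
have <- : mdeg m = d by have /dhomogP/(_ m mz) := hz.
rewrite mpolyXE_id mdegE expr_sum -big_split rmorph_prod /=.
by apply: eq_bigr => i _; rewrite rmorphXn substX ha exprMn.
Qed.

End Substitution.

(** * Spiders with a chord *)

(** The syzygies of a sequence regular modulo [L] are the Koszul ones, and putting [y] for [x] turns
    the Koszul relation of two indices into their minor, up to sign. In the induction, regularity
    expresses the last coefficient by the earlier terms, and the corresponding Koszul relations are
    subtracted. *)
Lemma ideal_koszul (V : eqType) (R : comNzRingType) (x y : V -> R) (L : seq R)
    (us : seq V) (h : V -> R) : uniq us ->
  (forall us1 u us2, us = us1 ++ u :: us2 -> nzd (x u) (L ++ map x us1)) ->
  \sum_(u <- us) h u * x u \in ideal_seq L ->
  \sum_(u <- us) h u * y u \in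
    ideal_seq (L ++ map (minor x y) [seq (u, v) | u <- us, v <- us]).
Proof.
elim/last_ind: us h => [|us w IH] h; first by move=> *; rewrite !big_nil ideal0.
rewrite rcons_uniq => /andP[wus uus] reg.
rewrite -cats1 !big_cat !big_seq1 /= => hL.
have hw : h w \in ideal_seq (L ++ map x us).
  apply: (reg us w [::]); first by rewrite cats1.
  apply/(ideal_cat_mapP x _ _ uus); exists (fun u => - h u).
  rewrite mulrC; under eq_bigr do rewrite mulNr.
  by rewrite sumrN opprK addrC.
have {hw}[c hc] := ideal_cat_mapP x L (h w) uus hw.
have {}hL : \sum_(u <- us) (h u + c u * x w) * x u \in ideal_seq L.
  rewrite (_ : \sum_(u <- us) _ = (\sum_(u <- us) h u * x u + h w * x w) -
      (h w - \sum_(u <- us) c u * x u) * x w).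
    exact/idealB/idealMr.
  under eq_bigr do rewrite mulrDl mulrAC.
  by rewrite big_split /= -mulr_suml; ring.
have hy : \sum_(u <- us) (h u + c u * x w) * y u \in
    ideal_seq (L ++ map (minor x y) [seq (u, v) | u <- us ++ [:: w], v <- us ++ [:: w]]).
  apply: ideal_sub_mem (IH _ uus _ hL) => [a|us1 u us2 e].
    rewrite !mem_cat => /orP[->//|/mapP[e /allpairsP[[u v] [/= uu vu ->]] ->]].
    by apply/orP; right; apply/map_f/allpairsP; exists (u, v); rewrite !mem_cat uu vu.
  by apply: (reg us1 u (rcons us2 w)); rewrite e rcons_cat rcons_cons.
rewrite (_ : _ + _ = \sum_(u <- us) (h u + c u * x w) * y u +
    \sum_(u <- us) c u * minor x y (u, w) + (h w - \sum_(u <- us) c u * x u) * y w).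
  apply: idealD; last by apply/idealMr/ideal_catl.
  apply: idealD => //; rewrite big_seq; apply: ideal_sum => u uu.
  apply/idealMl/ideal_mem; rewrite mem_cat; apply/orP; right.
  by apply/map_f/allpairsP; exists (u, w); rewrite !mem_cat uu !inE eqxx orbT.
rewrite mulrBl mulr_suml.
rewrite (_ : \sum_(u <- us) h u * y u = \sum_(u <- us) (h u + c u * x w) * y u +
    \sum_(u <- us) c u * minor x y (u, w) - \sum_(u <- us) c u * x u * y w).
  by ring.
rewrite -big_split -sumrB /=; apply: eq_bigr => u _.
by rewrite /minor /=; ring.
Qed.

Section Spider.
Variables (V : eqType) (R : comNzRingType) (x y : V -> R).
Variables (kx ky : V -> {rmorphism R -> R}) (graded : R -> Prop).
Implicit Types (z g m : R) (L : seq R) (u v : V).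

Hypotheses (kxP : forall v, kills (kx v) (x v)) (kyP : forall v, kills (ky v) (y v)).
Hypotheses (kx_x : forall u v, u != v -> kx v (x u) = x u).
Hypotheses (ky_y : forall u v, u != v -> ky v (y u) = y u).
Hypotheses (kx_y : forall u v, kx v (y u) = y u) (ky_x : forall u v, ky v (x u) = x u).
Hypotheses (graded_x : forall v, graded (x v)) (graded_y : forall v, graded (y v)).
Hypothesis graded_minor : forall e, graded (minor x y e).
Hypothesis sep_x : forall L v, {in L, forall a, graded a} -> separated L (x v).
Hypothesis sep_y : forall L v, {in L, forall a, graded a} -> separated L (y v).
Hypothesis radical0 : radical_seq ([::] : seq R).

(* [part d z] is the homogeneous component of degree [d] of [z]. *)
Variable part : nat -> R -> R.
Hypothesis ideal_part : forall L d z, {in L, forall a, graded a} ->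
  z \in ideal_seq L -> part d z \in ideal_seq L.
Hypothesis part_sum : forall z, exists N, z = \sum_(d < N) part d z.
Hypothesis part_minor : forall d e z, part d.+2 (minor x y e * z) = minor x y e * part d z.

Variables (k0 : V) (ls : seq (V * seq V)).
Hypothesis uls : uniq (k0 :: leg_vertices ls).

Local Notation X := (x k0).
Local Notation Y := (y k0).

(* Mutually inverse linear changes of coordinates up to powers of [X], under
   which the edge binomials [f v] at the center correspond to the variables [y v]. *)
Variables tau eps : {rmorphism R -> R}.
Hypotheses (tau_x : forall v, tau (x v) = X * x v) (tau_Y : tau Y = X * Y).
Hypotheses (eps_x : forall v, eps (x v) = X * x v).
Hypothesis tau_y : forall v, v != k0 -> tau (y v) = X * y v + Y * x v.
Hypothesis eps_y : forall v, v != k0 -> eps (y v) = X * y v - Y * x v.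
Hypothesis eps_tau : forall d z, eps (tau (part d z)) = X ^+ (3 * d) * part d z.

Let ideal_parts L z : (forall d, part d z \in ideal_seq L) -> z \in ideal_seq L.
Proof. by move=> h; have [N ->] := part_sum z; apply: ideal_sum. Qed.

Let f v := minor x y (k0, v).
Let I0 := map (minor x y) (leg_edges ls).
Let J us := I0 ++ map f us.
Let Iy us := I0 ++ map y us.
Let q := ideal_seq [:: X; Y].

Let uV : uniq (leg_vertices ls). Proof. by case/andP: uls. Qed.
Let k0V : k0 \notin leg_vertices ls. Proof. by case/andP: uls. Qed.

Let graded_minor_yx e : graded (minor y x e).
Proof.
rewrite (_ : minor y x e = minor x y (e.2, e.1)); first exact: graded_minor.
by rewrite /minor /=; ring.
Qed.

Let heads_sub (ls' : seq (V * seq V)) : {subset map fst ls' <= leg_vertices ls'}.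
Proof.
move=> _ /mapP[e els ->]; apply/flattenP; exists (e.1 :: e.2); rewrite ?mem_head //.
exact: (map_f (fun e : V * seq V => e.1 :: e.2)).
Qed.

(** * Regularity and radicality at the initial vertices of the legs *)

Lemma uniq_heads : uniq (map fst ls).
Proof.
elim: ls uV => [|e l IH] //; rewrite leg_vertices_cons -cat_cons cat_uniq.
case/and3P=> _ /hasPn dj /IH ul /=; rewrite ul andbT.
by apply: contraT; rewrite negbK => /heads_sub/dj; rewrite mem_head.
Qed.

Lemma heads_split us u vs : map fst ls = us ++ u :: vs ->
  exists ls1 l ls2, [/\ ls = ls1 ++ (u, l) :: ls2, us = map fst ls1 &
    {in us, forall w, w \notin u :: l}].
Proof.
move=> e; have eus : us = map fst (take (size us) ls) by rewrite map_take e take_size_cat.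
have := drop_size_cat (u :: vs) (erefl (size us)); rewrite -e -map_drop.
case ed : (drop _ ls) => [|[u' l] ls2] //= [eu _]; rewrite {}eu in ed.
have els := esym (cat_take_drop (size us) ls); rewrite ed in els.
exists (take (size us) ls), l, ls2; split=> // w wus.
have := uV; rewrite els /leg_vertices map_cat flatten_cat cat_uniq.
case/and3P=> _ /hasPn dj _; apply: contraL wus => wl; rewrite eus.
have /dj : w \in flatten [seq e0.1 :: e0.2 | e0 <- (u, l) :: ls2].
  by rewrite /= -cat_cons mem_cat wl.
by apply: contra => /heads_sub.
Qed.

Lemma x_heads_nzd us u vs : map fst ls = us ++ u :: vs -> nzd (x u) (I0 ++ map x us).
Proof.
case/heads_split=> ls1 [l [ls2 [els _ dus]]]; have uls' := uV.
rewrite /I0; rewrite els in uls' *.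
exact: (leg_head_nzd kxP kyP kx_x ky_y kx_y ky_x uls' dus).
Qed.

(** Exchanging the rows only changes signs, so the results on legs also hold for the [y]
    coordinates. *)
Lemma minors_swap s L : ideal_seq (map (minor y x) s ++ L) =i ideal_seq (map (minor x y) s ++ L).
Proof.
have e d : minor y x d = - minor x y d by rewrite /minor; ring.
move=> z; apply/idP/idP; apply: ideal_subset => a; rewrite mem_cat => /orP[/mapP[d ds ->]|aL];
  try by apply: ideal_mem; rewrite mem_cat aL orbT.
  by rewrite e; apply/idealN/ideal_mem; rewrite mem_cat map_f.
by rewrite -[minor x y d]opprK -e; apply/idealN/ideal_mem; rewrite mem_cat map_f.
Qed.

Lemma y_heads_nzd us u vs : map fst ls = us ++ u :: vs -> nzd (y u) (Iy us).
Proof.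
case/heads_split=> ls1 [l [ls2 [els _ dus]]]; have uls' := uV.
apply: eq_nzd (minors_swap _ _) _; rewrite els in uls' *.
exact: (leg_head_nzd kyP kxP ky_y kx_x ky_x kx_y uls' dus).
Qed.

Lemma y_heads_radical : radical_seq (Iy (map fst ls)).
Proof.
apply: eq_radical (minors_swap _ _) _.
exact: (leg_heads_radical kyP kxP ky_y kx_x ky_x kx_y graded_y graded_minor_yx sep_y
  (L := [::])).
Qed.

Lemma leg_edges_nzd i : (i < size (leg_edges ls))%N -> nzd I0`_i (take i I0).
Proof.
exact: (leg_edge_nzd kxP kyP kx_x ky_y kx_y ky_x graded_minor sep_x (L := [::])).
Qed.

Lemma graded_J us : {in J us, forall a, graded a}.
Proof. by move=> a; rewrite mem_cat => /orP[] /mapP[e _ ->]; exact: graded_minor. Qed.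

Lemma I0_free v : v \notin leg_vertices ls -> fixes (kx v) I0 /\ fixes (ky v) I0.
Proof. by move=> hv; exact: (free_legs kx_x ky_y kx_y ky_x hv). Qed.

Let f_q v : f v \in q.
Proof.
rewrite /f /minor; apply: idealB; [apply: idealMr|apply: idealMl];
  by apply: ideal_mem; rewrite !inE eqxx ?orbT.
Qed.

(** Both coordinates of the center are set to 0; the kernel is [q]. *)
Let phi z := ky k0 (kx k0 z).

Let phi_div z : z - phi z \in q.
Proof.
have [_ /(_ z)[h eh] _] := kxP k0; have [_ /(_ (kx k0 z))[g eg] _] := kyP k0.
rewrite {1}eh {1}eg -/(phi z) (_ : _ - _ = X * h + Y * g).
  by apply: idealD; apply: idealMr; apply: ideal_mem; rewrite !inE eqxx ?orbT.
by move: (phi z) X Y => a b c; ring.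
Qed.

Let phi_q z : z \in q -> phi z = 0.
Proof.
rewrite /phi; move: z; apply: ideal_seqP => [|a b ea eb|c a ea|a].
- by rewrite !rmorph0.
- by rewrite !rmorphD ea eb addr0.
- by rewrite !rmorphM ea mulr0.
rewrite !inE => /orP[] /eqP->; first by have [-> _ _] := kxP k0; rewrite rmorph0.
by rewrite kx_y; have [-> _ _] := kyP k0.
Qed.

Let ideal_q_mul L (w : R) m : X * m \in ideal_seq L -> Y * m \in ideal_seq L ->
  w \in q -> w * m \in ideal_seq L.
Proof.
move=> hX hY; move: w; apply: ideal_seqP => [|a b ha hb|c a ha|a].
- by rewrite mul0r ideal0.
- by rewrite mulrDl idealD.
- by rewrite -mulrA idealMl.
by rewrite !inE => /orP[] /eqP->.
Qed.

Let I0_J us z : z \in ideal_seq I0 -> z \in ideal_seq (J us).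
Proof. exact: ideal_catl. Qed.

Let f_J us u : u \in us -> f u \in ideal_seq (J us).
Proof. by move=> uus; apply: ideal_mem; rewrite mem_cat map_f ?orbT. Qed.

(** Write [X * g] as a combination of the [f u] modulo [I0] and split each coefficient as
    [h0 u + X * h' u]. The [h0 u] form a syzygy of the [x u], so [ideal_koszul] gives [g] as an
    element of [J us] plus a combination of minors of heads. As [g] lies in [q], the coefficients of
    these minors can be moved into [q], and [q] times such a minor lies in [J us]. *)
Lemma center_nzd us vs g : map fst ls = us ++ vs -> g \in q ->
  X * g \in ideal_seq (J us) -> g \in ideal_seq (J us).
Proof.
move=> eus gq hg; have := uniq_heads; rewrite eus cat_uniq => /andP[uus _].
have uneq u : u \in us -> u != k0.
  move=> uu; apply: contraNneq k0V => <-; apply: heads_sub.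
  by rewrite eus mem_cat uu.
have [kxX _ _] := kxP k0; have [fx fy] := I0_free k0V.
have [h hh] := ideal_cat_mapP f I0 (X * g) uus hg.
have [h' eh'] : exists h', forall u, h u = kx k0 (h u) + X * h' u.
  have [_ dv _] := kxP k0.
  by have [h' eh'] := choice (fun u => dv (h u)); exists h'.
pose h0 u := kx k0 (h u).
(* Setting [X] to 0 turns [f u] into [- (x u * Y)], and the variable [Y], absent from [I0],
   cancels. *)
have s1 : \sum_(u <- us) h0 u * x u \in ideal_seq I0.
  apply: (kills_nzd (kyP k0) fy).
  suff <- : kx k0 (X * g - \sum_(u <- us) h u * f u) = Y * \sum_(u <- us) h0 u * x u.
    exact: ideal_fixes.
  rewrite rmorphB rmorphM kxX mul0r sub0r rmorph_sum -sumrN mulr_sumr.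
  rewrite big_seq [RHS]big_seq; apply: eq_bigr => u /uneq uk.
  by rewrite rmorphM rmorphB !rmorphM /= !kx_y kxX kx_x // /h0; ring.
(* After the correction by [s1], the relation is divisible by [X], which is absent from [I0] and
   cancels. *)
have s2 : g - \sum_(u <- us) h' u * f u - \sum_(u <- us) h0 u * y u \in ideal_seq I0.
  apply: (kills_nzd (kxP k0) fx).
  rewrite (_ : _ * _ = (X * g - \sum_(u <- us) h u * f u) - Y * \sum_(u <- us) h0 u * x u).
    exact/idealB/idealMl.
  rewrite !mulrBr !mulr_sumr -!addrA -!opprD -!big_split /=; congr (_ - _).
  apply: eq_bigr => u _; rewrite {1}eh' -/(h0 u) /f /minor /=; ring.
have s3 : \sum_(u <- us) h0 u * y u \in
    ideal_seq (I0 ++ map (minor x y) [seq (u, v) | u <- us, v <- us]).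
  apply: ideal_koszul => // us1 u us2 e.
  by apply: (@x_heads_nzd _ _ (us2 ++ vs)); rewrite eus e -catA.
have [t tP et] : exists2 t : seq (R * (V * V)),
    {in t, forall e, e.2.1 \in us /\ e.2.2 \in us} &
    \sum_(u <- us) h0 u * y u - \sum_(e <- t) e.1 * minor x y e.2 \in ideal_seq I0.
  case/asboolP: s3 => s sP ->; elim: s sP => [|e s IH] sP.
    by exists [::] => //; rewrite !big_nil subr0 ideal0.
  have [d ds|t tP ht] := IH; first by apply: sP; rewrite in_cons ds orbT.
  have := sP e (mem_head _ _); rewrite mem_cat => /orP[eI|/mapP[d /allpairsP[p [p1 p2 ->]] ed]].
    exists t => //; rewrite big_cons -addrA; apply: idealD => //.
    by apply/idealMl/ideal_mem.
  exists ((e.1, (p.1, p.2)) :: t).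
    by move=> d'; rewrite inE => /orP[/eqP->|/tP].
  by rewrite !big_cons /= -ed opprD addrACA subrr add0r.
pose j1 := g - \sum_(e <- t) e.1 * minor x y e.2.
have j1J : j1 \in ideal_seq (J us).
  rewrite (_ : j1 = (g - \sum_(u <- us) h' u * f u - \sum_(u <- us) h0 u * y u) +
    (\sum_(u <- us) h0 u * y u - \sum_(e <- t) e.1 * minor x y e.2) +
    \sum_(u <- us) h' u * f u); last by rewrite /j1; ring.
  apply: idealD; first by apply/I0_J/idealD.
  by rewrite big_seq; apply: ideal_sum => u uu; apply/idealMl/f_J.
have phi_minor e : e.1 \in us -> e.2 \in us -> phi (minor x y e) = minor x y e.
  move=> /uneq e1 /uneq e2.
  by rewrite /phi /minor !rmorphB !rmorphM !kx_y !kx_x // !ky_x !ky_y.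
have phi_j1 : phi j1 = - \sum_(e <- t) phi e.1 * minor x y e.2.
  rewrite /j1 /phi !rmorphB -/(phi g) phi_q // sub0r !rmorph_sum; congr (- _).
  rewrite big_seq [RHS]big_seq; apply: eq_bigr => e /tP[e1 e2].
  by rewrite !rmorphM -!/(phi _) phi_minor.
have phi_j1J : phi j1 \in ideal_seq I0.
  rewrite /phi; move: {phi_j1} j1 j1J; apply: ideal_seqP => [|a b ha hb|c a ha|a].
  - by rewrite !rmorph0 ideal0.
  - by rewrite !rmorphD idealD.
  - by rewrite !rmorphM idealMl.
  rewrite mem_cat => /orP[aI|/mapP[u _ ->]]; first by rewrite fx // fy // ideal_mem.
  by rewrite -/(phi (f u)) phi_q ?ideal0.
(* Since [phi g] is 0, the term [phi j1] compensates for removing [phi e.1] from each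
   coefficient. *)
rewrite (_ : g = (j1 - phi j1) + \sum_(e <- t) (e.1 - phi e.1) * minor x y e.2).
  apply: idealD; first by apply: idealB => //; apply: I0_J.
  rewrite big_seq; apply: ideal_sum => e /tP[e1 e2].
  apply: ideal_q_mul (phi_div _).
    rewrite (_ : X * _ = x e.2.1 * f e.2.2 - x e.2.2 * f e.2.1).
      by apply: idealB; apply/idealMl/f_J.
    by rewrite /f /minor /=; ring.
  rewrite (_ : Y * _ = y e.2.1 * f e.2.2 - y e.2.2 * f e.2.1).
    by apply: idealB; apply/idealMl/f_J.
  by rewrite /f /minor /=; ring.
rewrite phi_j1 /j1; under [X in _ + X]eq_bigr do rewrite mulrBl.
by rewrite sumrB; ring.
Qed.

Lemma centerX_nzd us vs g N : map fst ls = us ++ vs -> g \in q ->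
  X ^+ N * g \in ideal_seq (J us) -> g \in ideal_seq (J us).
Proof.
move=> eus gq; elim: N => [|N IH]; first by rewrite mul1r.
by rewrite exprS -mulrA => /(center_nzd eus (idealMl _ gq))/IH.
Qed.

(** * Transport to coordinates in which the center edges are variables *)

Let vertex_neq v : v \in leg_vertices ls -> v != k0.
Proof. by apply: contraTneq => ->. Qed.

Let tau_f v : v != k0 -> tau (f v) = X ^+ 3 * y v.
Proof.
by move=> vk; rewrite rmorphB !rmorphM /= !tau_x tau_Y tau_y //; ring.
Qed.

Let eps_f v : v != k0 -> eps (y v) = f v.
Proof. by move=> vk; rewrite eps_y // /f /minor /=; ring. Qed.

(** Adding a multiple of the [x] row to the [y] row preserves minors, and the scaling of both rows
    gives [X ^+ 2]. The value 1 of [c] serves [tau], the value -1 serves [eps]. *)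
Let twist_minor (h : {rmorphism R -> R}) c e :
  (forall v, h (x v) = X * x v) ->
  (forall v, v != k0 -> h (y v) = X * y v + c * Y * x v) ->
  e \in leg_edges ls -> h (minor x y e) = X ^+ 2 * minor x y e.
Proof.
move=> hx hy /leg_edges_sub[/vertex_neq e1 /vertex_neq e2].
by rewrite rmorphB !rmorphM !hx !hy // /minor; ring.
Qed.

Let tau_J us : {in us, forall v, v != k0} ->
  {in ideal_seq (J us), forall z, tau z \in ideal_seq (Iy us)}.
Proof.
move=> usk; apply: ideal_morph => a; rewrite mem_cat => /orP[/mapP[e els ->]|/mapP[v vus ->]].
  rewrite (twist_minor (c := 1)) //; last by move=> v /tau_y ->; rewrite mul1r.
  by apply/idealMl/ideal_mem; rewrite mem_cat map_f.
by rewrite tau_f ?usk //; apply/idealMl/ideal_mem; rewrite mem_cat map_f ?orbT.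
Qed.

Let eps_Iy us : {in us, forall v, v != k0} ->
  {in ideal_seq (Iy us), forall z, eps z \in ideal_seq (J us)}.
Proof.
move=> usk; apply: ideal_morph => a; rewrite mem_cat => /orP[/mapP[e els ->]|/mapP[v vus ->]].
  rewrite (twist_minor (c := -1)) //; last by move=> v /eps_y ->; rewrite mulN1r mulNr.
  by apply/idealMl/ideal_mem; rewrite mem_cat map_f.
by rewrite eps_f ?usk ?f_J.
Qed.

Let X_nzd_Iy us : {in us, forall v, v != k0} -> nzd X (Iy us).
Proof.
move=> usk; apply: (kills_nzd (kxP k0)) => a; rewrite mem_cat.
by case/orP=> [/(I0_free k0V).1 //|/mapP[v vus ->]]; rewrite kx_y.
Qed.

Let heads_neq us vs : map fst ls = us ++ vs -> {in us, forall v, v != k0}.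
Proof.
move=> eus v vus; apply/vertex_neq/heads_sub.
by rewrite eus mem_cat vus.
Qed.

(** [tau] carries the relation into [Iy us], modulo which [X] and [y u] are nonzerodivisors; [eps]
    brings the result back up to a power of [X], which cancels on [q]. *)
Lemma star_edge_nzd us u vs g : map fst ls = us ++ u :: vs -> g \in q ->
  f u * g \in ideal_seq (J us) -> g \in ideal_seq (J us).
Proof.
move=> eus gq hg; have usk := heads_neq eus.
have uk : u != k0.
  by apply: (heads_neq (us := us ++ [:: u]) (vs := vs)); rewrite ?mem_cat ?inE ?eqxx ?orbT // -catA.
(* The composite of [tau] and [eps] is multiplication by a power of [X] only on each homogeneous
   component. *)
apply: ideal_parts => d.
have gdq : part d g \in q.
  by apply: ideal_part => // a; rewrite !inE => /orP[] /eqP->.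
have {}hg : f u * part d g \in ideal_seq (J us).
  by rewrite -part_minor; apply: ideal_part hg; apply: graded_J.
apply: (centerX_nzd (N := 3 * d) eus gdq); rewrite -eps_tau.
apply: (eps_Iy usk); apply: (y_heads_nzd eus); apply: (nzdX (X_nzd_Iy usk) (m := 3)).
by rewrite mulrA -tau_f // -rmorphM; apply: tau_J.
Qed.

(** The same transport, with radicality instead of a nonzerodivisor: once the powers of [X] are
    cancelled, a further factor [tau (part d z)] completes the square of [y w * tau (part d z)]. *)
Lemma chord_nzd w z : w != k0 ->
  f w * f w * z \in ideal_seq (J (map fst ls)) -> f w * z \in ideal_seq (J (map fst ls)).
Proof.
move=> wk hz; have eus : map fst ls = map fst ls ++ [::] by rewrite cats0.
have usk := heads_neq eus; have [N ez] := part_sum z.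
rewrite ez mulr_sumr; apply: ideal_sum => d _.
have {}hz : f w * f w * part d z \in ideal_seq (J (map fst ls)).
  by rewrite -mulrA -!part_minor mulrA; apply: ideal_part hz; apply: graded_J.
apply: (centerX_nzd (N := 3 * d) eus); first exact/idealMr/f_q.
rewrite mulrCA -eps_tau -eps_f // -rmorphM; apply: (eps_Iy usk).
apply: y_heads_radical; rewrite mulrACA mulrA; apply: idealMr.
(* Each of the two factors [f w] contributes [X ^+ 3]. *)
apply: (nzdX (X_nzd_Iy usk) (m := 6)).
rewrite (_ : _ * _ = tau (f w) * tau (f w) * tau (part d z)); last by rewrite tau_f //; ring.
by rewrite -!rmorphM; apply: tau_J.
Qed.

(** Three ranges of [i]: a leg edge is a nonzerodivisor modulo the earlier edges; a head edge is one
    on [q], which contains every multiple of [f]; for the chord only [j = i] remains. *)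
Theorem spider_chord_colon w (s := I0 ++ map f (rcons (map fst ls) w)) i j : w != k0 ->
  (i <= j < size s)%N ->
  colon (ideal_seq (take i s)) (s`_i * s`_j) =i colon (ideal_seq (take i s)) s`_j.
Proof.
move=> wk /andP[ij js] z; apply/idP/idP; rewrite /colon -!topredE /=; last first.
  by rewrite mulrCA; apply: idealMl.
have fnth l : (l < size (rcons (map fst ls) w))%N ->
    s`_(size I0 + l) = f (nth w (rcons (map fst ls) w) l).
  by move=> hl; rewrite nth_cat ltnNge leq_addr /= addKn (nth_map w).
have [iI|Ii] := ltnP i (size I0).
  have -> : take i s = take i I0 by rewrite take_cat iI.
  have -> : s`_i = I0`_i by rewrite nth_cat iI.
  by rewrite mulrCA; apply: leg_edges_nzd; rewrite -(size_map (minor x y)).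
have ei := subnKC Ii; have ej := subnKC (leq_trans Ii ij).
move: (i - size I0)%N (j - size I0)%N ei ej => i' j' ei ej.
move: ij js; rewrite -ei -ej leq_add2l size_cat size_map ltn_add2l => ij js.
have is' := leq_ltn_trans ij js; rewrite !fnth //.
have -> : take (size I0 + i') s = J (take i' (rcons (map fst ls) w)).
  by rewrite /J take_cat ltnNge leq_addr /= addKn map_take.
move: is'; rewrite size_rcons ltnS leq_eqVlt => /orP[/eqP e|il].
  have -> : j' = i' by apply/eqP; rewrite eqn_leq ij andbT e -ltnS -(size_rcons _ w).
  rewrite e nth_rcons ltnn eqxx -cats1 take_size_cat // mulrC ![z * _]mulrC.
  exact: chord_nzd.
rewrite [nth w _ i']nth_rcons il -cats1 takel_cat ?(ltnW il) // mulrCA.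
have eus : map fst ls = take i' (map fst ls) ++
    nth w (map fst ls) i' :: drop i'.+1 (map fst ls).
  by rewrite -drop_nth // cat_take_drop.
by apply: (star_edge_nzd eus); apply/idealMl/f_q.
Qed.

End Spider.

(** * Edge binomials *)

Section EdgeBinomials.
Variables (k : fieldType) (n : nat).
Local Notation S := {mpoly k[n + n]}.
Local Notation x := (@xvar k n).
Local Notation y := (@yvar k n).

Lemma homog_edge u v : edge_binomial k u v \is 2.-homog for (@mdeg (n + n)).
Proof.
by apply: rpredB; apply: (@dhomogM _ _ _ 1 _ 1); rewrite ?homogeneousX.
Qed.

Section Twist.
Variables (k0 : 'I_n) (c : S).

(** The shear adding [c * y k0 / x k0] times the [x] row to the [y] row away from [k0], with
    denominators cleared. The values 1 and -1 of [c] give [tau] and [eps]. *)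
Definition twist : {rmorphism S -> S} := subst (fun i => match split i with
  | inl v => x k0 * x v
  | inr v => if v == k0 then x k0 * y k0 else x k0 * y v + c * y k0 * x v
  end).

Lemma twist_x v : twist (x v) = x k0 * x v.
Proof. by rewrite /twist substX (unsplitK (inl v : 'I_n + 'I_n)). Qed.

Lemma twist_y v : v != k0 -> twist (y v) = x k0 * y v + c * y k0 * x v.
Proof. by move=> /negPf vk; rewrite /twist substX (unsplitK (inr v : 'I_n + 'I_n)) vk. Qed.

Lemma twist_y0 : twist (y k0) = x k0 * y k0.
Proof. by rewrite /twist substX (unsplitK (inr k0 : 'I_n + 'I_n)) eqxx. Qed.

Lemma twistC (a : k) : twist a%:MP = a%:MP.
Proof. exact: substC. Qed.

End Twist.

(** The shears cancel. The exponent is 3 because the factor [x k0] from the first map is squared by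
    the second, which also scales the variable itself. *)
Lemma twistK k0 z : twist k0 (-1) (twist k0 1 z) = subst (fun i => x k0 ^+ 3 * 'X_i) z.
Proof.
apply: morph_comp_ext z => [a|i]; first by rewrite (twistC k0 1) (twistC k0 (-1)) substC.
rewrite (substX (fun i => x k0 ^+ 3 * 'X_i)) -(splitK i); case: (split i) => v.
  rewrite -[unsplit _]/(lshift n v) -/(x v) (twist_x k0 1 v) (rmorphM (twist k0 (-1))).
  by rewrite !(twist_x k0 (-1)); ring.
rewrite -[unsplit _]/(rshift n v) -/(y v); have [->|vk] := eqVneq v k0.
  rewrite (twist_y0 k0 1) (rmorphM (twist k0 (-1))).
  by rewrite (twist_x k0 (-1)) (twist_y0 k0 (-1)); ring.
rewrite (twist_y 1 vk) (rmorphD (twist k0 (-1))) !(rmorphM (twist k0 (-1))).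
by rewrite rmorph1 !(twist_x k0 (-1)) (twist_y0 k0 (-1)) (twist_y (-1) vk); ring.
Qed.

Lemma edge_binomials_colon (k0 w : 'I_n) (ls : seq ('I_n * seq 'I_n))
    (s := map (minor x y) (leg_edges ls) ++
          map (edge_binomial k k0) (rcons (map fst ls) w)) i j :
  uniq (k0 :: leg_vertices ls) -> w != k0 -> (i <= j < size s)%N ->
  colon (ideal_seq (take i s)) (s`_i * s`_j) =i colon (ideal_seq (take i s)) s`_j.
Proof.
move=> uls wk ijs.
apply: (@spider_chord_colon _ _ x y (fun v => kill k (lshift n v)) (fun v => kill k (rshift n v))
  (@homogeneous k (n + n)) _ _ _ _ _ _ _ _ _ _ _ _ (fun d => pihomog (@mdeg _) d) _ _ _
  k0 ls uls (twist k0 1) (twist k0 (-1))) => //.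
- by move=> v; apply: killP.
- by move=> v; apply: killP.
- by move=> u v /negPf uv; rewrite killX eq_lshift uv.
- by move=> u v /negPf uv; rewrite killX eq_rshift uv.
- by move=> u v; rewrite killX eq_rlshift.
- by move=> u v; rewrite killX eq_lrshift.
- by move=> v; exists 1%N; apply: homogeneousX.
- by move=> v; exists 1%N; apply: homogeneousX.
- by move=> e; exists 2; apply: homog_edge.
- by move=> L v; apply: homogeneous_separated.
- by move=> L v; apply: homogeneous_separated.
- move=> z /asboolP[t t0 zz]; suff /eqP : z * z = 0.
    by rewrite mulf_eq0 orbb => /eqP ->; apply: ideal0.
  by rewrite zz big_seq big1 // => u /t0.
- by move=> L d z; apply: ideal_pihomog.
- by move=> z; exists (mmeasure (@mdeg _) z); apply: pihomog_partitionE.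
- by move=> d e z; rewrite mulrC (pihomogM _ _ (homog_edge e.1 e.2)) /= !subSS subn0 mulrC.
- exact: twist_x.
- exact: twist_y0.
- exact: twist_x.
- by move=> v vk; rewrite twist_y // mul1r.
- by move=> v vk; rewrite twist_y // !mulN1r mulNr.
move=> d z; rewrite twistK exprM.
by apply: homog_subst_scale => //; apply: pihomogP.
Qed.

(** At the point [pt e] the binomial of [e] takes the value 1 and all others vanish, so none lies in
    the ideal of the others. *)
Lemma edge_binomials_minimal (E : seq ('I_n * 'I_n)) : uniq E ->
  {in E, forall e : 'I_n * 'I_n, (e.1 < e.2)%N} -> minimal_generators (map (minor x y) E).
Proof.
move=> uE ltE.
pose pt (e : 'I_n * 'I_n) (i : 'I_(n + n)) : k :=
  match split i with inl v => (v == e.1)%:R | inr v => (v == e.2)%:R end.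
have ev e d : e \in E -> d \in E -> (minor x y d).@[pt e] = (d == e)%:R.
  move=> eE dE; rewrite rmorphB !rmorphM /= !mevalXU /pt.
  rewrite !(unsplitK (inl _ : 'I_n + 'I_n)) !(unsplitK (inr _ : 'I_n + 'I_n)).
  (* The second product is nonzero only if [d] is [e] reversed, which the ordering of endpoints
     excludes. *)
  rewrite -!natrM !mulnb [X in _ - X](_ : _ = 0) ?subr0 //.
  case: eqP => //= e1; case: eqP => //= e2.
  by have := ltE _ dE; rewrite e1 e2 ltnNge (ltnW (ltE _ eE)).
have inj : {in E &, injective (minor x y)}.
  move=> d e dE eE /(congr1 (meval (pt e))); rewrite !ev // eqxx.
  by case: eqP => // _ /eqP; rewrite eq_sym oner_eq0.
move=> t ts et; have us : uniq (map (minor x y) E) by rewrite map_inj_in_uniq.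
have /(subseq_uniqP us) -> := ts.
apply/all_filterP/allP => a /mapP[e eE ->]; apply: contraT => nt.
have : minor x y e \in ideal_seq t by rewrite et; apply/ideal_mem/map_f.
case/asboolP=> r rt /(congr1 (meval (pt e))); rewrite ev // eqxx rmorph_sum big_seq big1.
  by move/eqP; rewrite oner_eq0.
move=> u /rt ut; rewrite rmorphM /=.
have /mapP[d dE ud] := mem_subseq ts ut; rewrite ud ev //.
case: eqP => [de|_]; last by rewrite mulr0.
by move: nt; rewrite -de -ud ut.
Qed.

Definition sort_edge (e : 'I_n * 'I_n) := if (e.1 < e.2)%N then e else (e.2, e.1).

Lemma minor_sort_edge e :
  minor x y (sort_edge e) = minor x y e \/ minor x y (sort_edge e) = - minor x y e.
Proof.
by rewrite /sort_edge; case: ifP => _; [left|right; rewrite /minor /=; ring].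
Qed.

(** [E] orients edges by the construction, [edge_binomials] by the order of vertices. Reorienting
    only changes signs, which affects neither the ideals nor the colons. *)
Lemma edge_binomials_d_sequence (k0 w : 'I_n) (ls : seq ('I_n * seq 'I_n)) (G : sgraph 'I_n)
    (E := leg_edges ls ++ [seq (k0, u) | u <- rcons (map fst ls) w]) :
  uniq (k0 :: leg_vertices ls) -> w != k0 -> uniq (map sort_edge E) ->
  (forall a b, G a b = ((a, b) \in E) || ((b, a) \in E)) ->
  edge_binomials_form_d_sequence k G.
Proof.
move=> uls wk uE GE.
have irr e : e \in E -> e.1 != e.2.
  case: e => a b eE; apply/eqP => /= ab; rewrite -ab in eE.
  by have := adj_irrefl G a; rewrite GE eE.
have ltE : {in map sort_edge E, forall e : 'I_n * 'I_n, (e.1 < e.2)%N}.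
  move=> _ /mapP[e /irr ne ->]; rewrite /sort_edge.
  move: ne; rewrite -val_eqE /=; case: (ltngtP e.1 e.2) => //=.
exists (map (minor x y) (map sort_edge E)); split.
  apply: perm_map; apply: uniq_perm => //; first by rewrite filter_uniq ?enum_uniq.
  move=> [a b]; rewrite mem_filter mem_enum andbT /= GE.
  apply/mapP/andP => [[[c d] cdE]|[ab /orP[abE|baE]]].
  - rewrite /sort_edge /=; have := irr _ cdE; rewrite /= -val_eqE /=.
    by case: ltngtP => //= cd _ [-> ->]; rewrite cdE ?orbT.
  - by exists (a, b) => //; rewrite /sort_edge /= ab.
  - by exists (b, a) => //; rewrite /sort_edge /= ltnNge ltnW.
split; first exact: edge_binomials_minimal.
move=> i j /andP[ij]; rewrite !size_map => jE z.
have iE := leq_ltn_trans ij jE.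
have := @edge_binomials_colon k0 w ls i j uls wk.
rewrite (_ : _ ++ _ = map (minor x y) E); last by rewrite map_cat -map_comp.
rewrite size_map ij jE => /(_ isT z).
rewrite -map_comp -!map_take !(nth_map (k0, k0)) //.
set L := map (minor x y) _; set L' := map _ _.
have eL : ideal_seq L' =i ideal_seq L.
  move=> a; apply/idP/idP; apply: ideal_subset => _ /mapP[e eE ->] /=.
    by have [->|->] := minor_sort_edge e; [|apply: idealN]; apply/ideal_mem/map_f.
  have [me|me] := minor_sort_edge e; last rewrite -[minor x y e]opprK.
    by rewrite -me; apply/ideal_mem/(map_f (minor x y \o sort_edge)).
  by rewrite -me; apply/idealN/ideal_mem/(map_f (minor x y \o sort_edge)).
have sgn (a b : S) : b = a \/ b = - a -> (b \in ideal_seq L) = (a \in ideal_seq L).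
  by case=> ->; apply/idP/idP => [/idealN|/idealN]; rewrite ?opprK // => /idealN; rewrite opprK.
move: (nth _ E i) (nth _ E j) => d e h.
rewrite -[LHS]/(z * _ \in ideal_seq L') -[RHS]/(z * _ \in ideal_seq L') !eL.
have {}h : (z * (minor x y d * minor x y e) \in ideal_seq L) = (z * minor x y e \in ideal_seq L).
  exact: h.
rewrite (sgn (z * (minor x y d * minor x y e))
  (z * ((minor x y \o sort_edge) d * (minor x y \o sort_edge) e))).
  rewrite h; apply/esym/sgn.
  by case: (minor_sort_edge e) => /= ->; [left|right; rewrite mulrN].
by case: (minor_sort_edge d) => /= ->; case: (minor_sort_edge e) => ->;
  [left|right|right|left]; ring.
Qed.

End EdgeBinomials.

(** * Symmetric and Rees algebras of a d-sequence *)

Section SymAlg.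
Import ring_quotient finmap monalg.
Variables (R : comNzRingType) (M : lmodType R).
Local Notation FA := (free_alg M).
Local Notation A := (sym_alg M).

Lemma malg_scaleU (K : monomType) (c : R) (m : K) :
  mkmalgU m c = c *: mkmalgU m 1 :> {malg R[K]}.
Proof. by apply/malgP => j; rewrite mcoeffZ !mcoeffU mulrnAr mulr1. Qed.

Lemma free_alg_ind (P : FA -> Prop) :
  P 0 -> P 1 -> (forall p q, P p -> P q -> P (p + q)) -> (forall p q, P p -> P q -> P (p * q)) ->
  (forall r p, P p -> P (r *: p)) -> (forall m, P (free_var m)) -> forall p, P p.
Proof.
move=> P0 P1 PD PM PZ PV.
have PU (m : {cmonom M}) : P (<< m >>%R : FA).
  elim: {m}(mdeg m) {-2}m (erefl (mdeg m)) => [|d IH] m dm.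
    by rewrite (mdeg_eq0I dm); exact: P1.
  have [i im] : exists i, i \in finsupp m.
    case: (fset_0Vmem (finsupp m)) => [m0|[i im]]; last by exists i.
    by move: dm; rewrite mdegE m0 big_seq_fset0.
  (* One variable occurring in the monomial is split off, lowering the degree. *)
  have em : m = mmul (ucm i) (divcm m (ucm i)).
    apply/eqP/cmP => j; rewrite cmM divcmE subnKC // cmU.
    by case: eqP => //= <-; rewrite lt0n cmE_neq0.
  have -> : (<< m >>%R : FA) = << ucm i >> * << divcm m (ucm i) >>.
    by rewrite malgM_def fgmulUU mulr1 -em.
  apply: (PM) (PV i) _; apply: IH; move: dm.
  by rewrite {1}em mdegM mdegU add1n => -[].
move=> p; rewrite [p]monalgE; elim/big_ind: _ => [|q1 q2|m _]; [exact: P0|exact: PD|].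
have -> : mkmalgU m (mcoeff m p) = mcoeff m p *: (<< m >> : FA).
  exact: malg_scaleU.
exact/PZ/PU.
Qed.

Lemma sym_projD p q : sym_proj (p + q) = sym_proj p + sym_proj q :> A.
Proof. exact: (rmorphD \pi_{ideal_quot (@sym_rel R M)}%qT). Qed.

Lemma sym_projM p q : sym_proj (p * q) = sym_proj p * sym_proj q :> A.
Proof. exact: (rmorphM \pi_{ideal_quot (@sym_rel R M)}%qT). Qed.

Lemma sym_proj1 : sym_proj 1 = 1 :> A.
Proof. exact: (rmorph1 \pi_{ideal_quot (@sym_rel R M)}%qT). Qed.

Lemma sym_proj0 : sym_proj 0 = 0 :> A.
Proof. exact: (rmorph0 \pi_{ideal_quot (@sym_rel R M)}%qT). Qed.

Definition sym_const (r : R) : A := sym_proj (r *: 1).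

Definition sym_var (m : M) : A := sym_proj (free_var m).

Lemma sym_constD r t : sym_const (r + t) = sym_const r + sym_const t.
Proof. by rewrite /sym_const scalerDl sym_projD. Qed.

Lemma sym_constM r t : sym_const (r * t) = sym_const r * sym_const t.
Proof. by rewrite /sym_const -sym_projM -scalerAl mul1r scalerA. Qed.

Lemma sym_const1 : sym_const 1 = 1.
Proof. by rewrite /sym_const scale1r sym_proj1. Qed.

Lemma sym_const0 : sym_const 0 = 0.
Proof. by rewrite /sym_const scale0r sym_proj0. Qed.

Lemma sym_var_linear r m m' : sym_var (r *: m + m') = sym_const r * sym_var m + sym_var m'.
Proof.
rewrite /sym_var /sym_const -sym_projM -sym_projD -scalerAl mul1r.
apply/eqP; rewrite /sym_proj -Quotient.idealrBE opprD addrA; apply: ideal_gen_sub.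
by exists r, m, m'.
Qed.

Lemma sym_alg_ind (P : A -> Prop) :
  (forall r, P (sym_const r)) -> (forall m, P (sym_var m)) ->
  (forall a b, P a -> P b -> P (a + b)) -> (forall a b, P a -> P b -> P (a * b)) ->
  forall a, P a.
Proof.
move=> PC PV PD PM a; rewrite -(sym_projK a).
elim/free_alg_ind: (repr _) => [||p q hp hq|p q hp hq|r p hp|m].
- by rewrite sym_proj0 -sym_const0; apply: PC.
- by rewrite sym_proj1 -sym_const1; apply: PC.
- by rewrite sym_projD; apply: PD.
- by rewrite sym_projM; apply: PM.
- by rewrite -[p]mul1r scalerAl sym_projM; apply: PM; first exact: PC.
exact: PV.
Qed.

End SymAlg.

Lemma d_sequence_colon (R : comNzRingType) (s : seq R) i z : d_sequence s -> (i < size s)%N ->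
  z \in ideal_seq s -> z * s`_i \in ideal_seq (take i s) -> z \in ideal_seq (take i s).
Proof.
move=> [_ ds] is_ zs hz.
have hj j : (i <= j < size s)%N -> z * s`_j \in ideal_seq (take i s).
  move=> ij; have := ds i j ij z; rewrite -[RHS]/(z * s`_j \in _) => <-.
  by rewrite -[_ \in _]/(z * (s`_i * s`_j) \in _) mulrA; apply: idealMr.
have sub l : (i <= l)%N -> {subset ideal_seq (take i s) <= ideal_seq (take l s)}.
  move=> il; apply: ideal_sub_mem => a; rewrite -[take i s](take_takel _ il).
  exact: mem_take.
have down l : (l <= size s)%N -> z \in ideal_seq (take l s) -> z \in ideal_seq (take i s).
  elim: l => [|l IH] ls hl; first by apply: ideal_sub_mem hl; rewrite take0.
  have [li|il] := leqP l.+1 i.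
    by apply: ideal_sub_mem hl => a; rewrite -[take l.+1 s](take_takel _ li); apply: mem_take.
  rewrite ltnS in il; apply: IH; first exact: ltnW.
  move: hl; rewrite (take_nth 0) // => hl.
  have {}hl : z \in ideal_seq (s`_l :: take l s).
    by apply: ideal_sub_mem hl => a; rewrite mem_rcons.
  case/ideal_consP: hl => c hc.
  have h2 : c * (s`_l * s`_l) \in ideal_seq (take l s).
    rewrite (_ : c * _ = z * s`_l - (z - c * s`_l) * s`_l); last by ring.
    apply: idealB; last exact: idealMr.
    by apply: (sub l il); apply: hj; rewrite il ls.
  have h1 : c * s`_l \in ideal_seq (take l s).
    by have := ds l l; rewrite leqnn ls => /(_ isT c) e;
    rewrite -[_ \in _]/(c \in colon _ s`_l) -e.
  by rewrite -(subrK (c * s`_l) z); apply: idealD.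
by apply: (down (size s)); rewrite ?take_size.
Qed.

(* The ring A stands for the symmetric algebra and rees_val for its map to R[t]. *)
Section SymToRees.
Variables (R : comNzRingType) (I : submodClosed R^o) (s : seq R).
Hypotheses (Is : I =i ideal_seq s) (ds : d_sequence s).
Local Notation M := (ideal_module I).
Variables (A : comNzRingType) (sconst : R -> A) (svar : M -> A) (rees_val : A -> {poly R}).
Hypothesis sconstD : forall r t, sconst (r + t) = sconst r + sconst t.
Hypothesis sconstM : forall r t, sconst (r * t) = sconst r * sconst t.
Hypotheses (sconst0 : sconst 0 = 0) (sconst1 : sconst 1 = 1).
Hypothesis svar_linear : forall r m m', svar (r *: m + m') = sconst r * svar m + svar m'.
Hypothesis sym_ind : forall P : A -> Prop, (forall r, P (sconst r)) -> (forall m, P (svar m)) ->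
  (forall a b, P a -> P b -> P (a + b)) -> (forall a b, P a -> P b -> P (a * b)) -> forall a, P a.
Hypothesis rees_valD : forall u v, rees_val (u + v) = rees_val u + rees_val v.
Hypothesis rees_valM : forall u v, rees_val (u * v) = rees_val u * rees_val v.
Hypothesis rees_val_const : forall r, rees_val (sconst r) = r%:P.
Hypothesis rees_val_var : forall m, rees_val (svar m) = val m *: 'X.
Implicit Types (u v : A) (r c : R).

Lemma nth_in_ideal k : s`_k \in I.
Proof.
rewrite Is; have [ks|sk] := ltnP k (size s); first exact/ideal_mem/mem_nth.
(* Past the end of the list the default value is 0, so [gen] can be indexed by all natural
   numbers. *)
by rewrite nth_default ?ideal0.
Qed.

Let gen k : A := svar (Sub s`_k (nth_in_ideal k) : M).

(** Forms of degree [d] in the generators. This is only a predicate; independence of the different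
    degrees is not built in. *)
Fixpoint sym_graded d : A -> Prop := if d is d'.+1 then
    fun u => exists2 G : nat -> A, (forall i, sym_graded d' (G i)) &
      u = \sum_(i < size s) gen i * G i
  else fun u => exists r, u = sconst r.

Lemma sym_graded0 d : sym_graded d 0.
Proof.
elim: d => [|d IH]; first by exists 0; rewrite sconst0.
by exists (fun=> 0) => //; rewrite big1 // => i _; rewrite mulr0.
Qed.

Lemma sym_gradedD d u v : sym_graded d u -> sym_graded d v -> sym_graded d (u + v).
Proof.
elim: d u v => [|d IH] u v; first by move=> [r ->] [t ->]; exists (r + t); rewrite sconstD.
move=> [G hG ->] [H hH ->]; exists (fun i => G i + H i).
  by move=> i; apply: IH; [exact: hG|exact: hH].
by rewrite -big_split /=; apply: eq_bigr => i _; rewrite mulrDr.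
Qed.

Lemma sym_graded_sum d (J : Type) (r : seq J) (P : pred J) (F : J -> A) :
  (forall j, P j -> sym_graded d (F j)) -> sym_graded d (\sum_(j <- r | P j) F j).
Proof.
by move=> h; elim/big_ind: _ => //; [exact: sym_graded0|exact: sym_gradedD].
Qed.

Lemma sym_graded_gen d i u : (i < size s)%N -> sym_graded d u -> sym_graded d.+1 (gen i * u).
Proof.
move=> is_ hu; exists (fun j => if j == i then u else 0).
  by move=> j; case: eqP => // _; apply: sym_graded0.
rewrite (bigD1 (Ordinal is_)) //= eqxx big1 ?addr0 // => j /eqP ji.
by case: eqP => [e|]; rewrite ?mulr0 //; case: ji; apply: val_inj.
Qed.

Lemma sym_gradedM d e u v : sym_graded d u -> sym_graded e v -> sym_graded (d + e) (u * v).
Proof.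
elim: d u => [|d IH] u.
  case=> r ->; elim: e v => [|e IH] v; first by case=> t ->; exists (r * t); rewrite sconstM.
  case=> G hG ->; exists (fun i => sconst r * G i).
    by move=> i; apply: IH; exact: hG.
  by rewrite mulr_sumr; apply: eq_bigr => i _; rewrite mulrCA.
case=> G hG -> hv; rewrite mulr_suml; apply: sym_graded_sum => i _.
by rewrite -mulrA; apply: sym_graded_gen => //; apply: IH => //; exact: hG.
Qed.

Lemma ideal_takeP i z : (i <= size s)%N -> z \in ideal_seq (take i s) ->
  exists c : nat -> R, z = \sum_(j < i) c j * s`_j.
Proof.
move=> is_; move: z; apply: ideal_seqP => [|a b [c ->] [d ->]|r a [c ->]|a].
- by exists (fun=> 0); rewrite big1 // => j _; rewrite mul0r.
- exists (fun j => c j + d j); rewrite -big_split /=.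
  by apply: eq_bigr => j _; rewrite mulrDl.
- exists (fun j => r * c j); rewrite mulr_sumr.
  by apply: eq_bigr => j _; rewrite mulrA.
case/(nthP 0) => j; rewrite size_take_min (minn_idPl is_) => ji <-.
exists (fun l => (l == j)%:R); rewrite (bigD1 (Ordinal ji)) //= eqxx mul1r nth_take //.
rewrite big1 ?addr0 // => l /eqP lj; case: eqP => [e|]; rewrite ?mul0r //.
by case: lj; apply: val_inj.
Qed.

Lemma svar_sum i (c : nat -> R) (m : M) : val m = \sum_(j < i) c j * s`_j ->
  svar m = \sum_(j < i) sconst (c j) * gen j.
Proof.
elim: i m => [|i IH] m; rewrite ?big_ord0 ?big_ord_recr /= => em.
  have -> : m = 0 by apply: val_inj; exact: em.
  have := svar_linear 1 (0 : M) 0; rewrite scaler0 addr0 sconst1 mul1r.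
  by move/eqP; rewrite -subr_eq0 opprD addrA subrr sub0r oppr_eq0 => /eqP.
pose g : M := Sub s`_i (nth_in_ideal i).
have hm : val (m - c i *: g) = \sum_(j < i) c j * s`_j.
  by rewrite -[RHS](addrK (c i * s`_i)) -em.
have em' : m = c i *: g + (m - c i *: g) by rewrite addrC subrK.
by rewrite -(IH _ hm) [in LHS]em' svar_linear addrC.
Qed.

Lemma sym_graded_var (m : M) : sym_graded 1 (svar m).
Proof.
have [|c em] := @ideal_takeP (size s) (val m) (leqnn _).
  by rewrite take_size -Is; apply: (valP m).
rewrite (svar_sum em); apply: sym_graded_sum => j _.
by apply: (@sym_gradedM 0 1); [exists (c j)|rewrite -[gen j]mulr1; apply: sym_graded_gen => //;
  exists 1; rewrite sconst1].
Qed.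

Definition rees_coef d u := (rees_val u)`_d.

Lemma rees_coefD d u v : rees_coef d (u + v) = rees_coef d u + rees_coef d v.
Proof. by rewrite /rees_coef rees_valD coefD. Qed.

Lemma rees_coef0 d : rees_coef d 0 = 0.
Proof.
by apply/eqP; rewrite -(inj_eq (addrI (rees_coef d 0))) -rees_coefD !addr0.
Qed.

Lemma rees_coef_sum d (J : Type) (r : seq J) (P : pred J) (F : J -> A) :
  rees_coef d (\sum_(j <- r | P j) F j) = \sum_(j <- r | P j) rees_coef d (F j).
Proof. exact: (big_morph _ (rees_coefD d) (rees_coef0 d)). Qed.

Lemma rees_coef_gen d i u : rees_coef d.+1 (gen i * u) = s`_i * rees_coef d u.
Proof. by rewrite /rees_coef rees_valM rees_val_var /= -scalerAl coefZ coefXM. Qed.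

Lemma rees_coef_const r : rees_coef 0 (sconst r) = r.
Proof. by rewrite /rees_coef rees_val_const coefC. Qed.

Lemma rees_val0 : rees_val (0 : A) = 0.
Proof.
by apply/eqP; rewrite -(inj_eq (addrI (rees_val 0))) -rees_valD !addr0.
Qed.

Lemma rees_val_graded d u : sym_graded d u -> rees_val u = rees_coef d u *: 'X^d.
Proof.
elim: d u => [|d IH] u.
  by case=> r ->; rewrite rees_coef_const rees_val_const expr0 alg_polyC.
case=> G hG ->; rewrite rees_coef_sum scaler_suml.
rewrite (big_morph _ rees_valD rees_val0); apply: eq_bigr => i _.
rewrite rees_coef_gen rees_valM rees_val_var /= (IH _ (hG i)).
by rewrite -scalerAl -scalerAr scalerA exprS.
Qed.

Lemma sym_graded_coef_take d i u : (i <= size s)%N -> sym_graded d.+1 u ->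
  rees_coef d.+1 u \in ideal_seq (take i s) ->
  exists2 G : nat -> A, (forall j, sym_graded d (G j)) & u = \sum_(j < i) gen j * G j.
Proof.
elim/ltn_ind: d i u => d IHd i u is_; move ei: (size s - i)%N => e.
elim: e => [|e IHe] in i u is_ ei *; move=> hu hc.
  have -> : i = size s by apply/eqP; rewrite eqn_leq is_ -subn_eq0 ei.
  exact: hu.
have li : (i < size s)%N by rewrite -subn_gt0 ei.
have hc' : rees_coef d.+1 u \in ideal_seq (take i.+1 s).
  by apply: ideal_sub_mem hc => a; rewrite -[take i s](take_takel _ (leqnSn i)); apply: mem_take.
have [|G hG eu] := IHe i.+1 u li _ hu hc'; first by rewrite subnS ei.
suff [H hH eH] : exists2 H : nat -> A, (forall j, sym_graded d (H j)) &
    gen i * G i = \sum_(j < i) gen j * H j.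
  exists (fun j => G j + H j).
    by move=> j; apply: (@sym_gradedD d); [exact: hG|exact: hH].
  have {}eu : u = \sum_(j < i) gen j * G j + gen i * G i by rewrite eu big_ord_recr.
  by rewrite eu eH -big_split; apply: eq_bigr => j _; rewrite mulrDr.
move: hc; rewrite eu big_ord_recr /= rees_coefD rees_coef_gen rees_coef_sum => hc.
have {}hc : s`_i * rees_coef d (G i) \in ideal_seq (take i s).
  rewrite -[X in X \in _](addKr (\sum_(j < i) rees_coef d.+1 (gen j * G j))) addrC.
  apply: idealB => //; apply: ideal_sum => j _; rewrite rees_coef_gen.
  by apply/idealMr/ideal_mem; rewrite -(nth_take 0 (ltn_ord j)) mem_nth // size_takel.
move: (G i) (hG i) hc => v {G hG eu hu hc' IHe u}.
(* In degree 0 the value need not lie in the ideal of [s]; there the relation lifts by linearity of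
   [svar]. *)
case: d IHd => [|d] IHd hv hc.
  have [r er] := hv; move: hc; rewrite er rees_coef_const => hc.
  have [c ec] := ideal_takeP is_ hc.
  pose g : M := Sub s`_i (nth_in_ideal i).
  exists (fun j => sconst (c j)); first by move=> j; exists (c j).
  under eq_bigr do rewrite mulrC.
  rewrite -(svar_sum (m := r *: g)); last by rewrite -ec mulrC.
  have v0 : svar (0 : M) = 0 by rewrite (svar_sum (i := 0) (c := c)) ?big_ord0.
  by rewrite -[r *: g]addr0 svar_linear v0 addr0 mulrC.
have vs : rees_coef d.+1 v \in ideal_seq s.
  have [H _ ->] := hv; rewrite rees_coef_sum; apply: ideal_sum => j _.
  by rewrite rees_coef_gen; apply/idealMr/ideal_mem/mem_nth.
have [|H hH ->] := IHd d (ltnSn d) i v is_ hv.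
  by apply: d_sequence_colon ds li vs _; rewrite mulrC.
exists (fun j => gen i * H j); first by move=> j; apply: sym_graded_gen.
by rewrite mulr_sumr; apply: eq_bigr => j _; rewrite mulrCA.
Qed.

Lemma sym_graded_inj d u : sym_graded d u -> rees_coef d u = 0 -> u = 0.
Proof.
case: d => [[r ->]|d hu u0]; first by rewrite rees_coef_const => ->; rewrite sconst0.
have [|G _ ->] := @sym_graded_coef_take d 0 u (leq0n _) hu; last by rewrite big_ord0.
by rewrite u0 ideal0.
Qed.

Lemma sym_graded_split u : exists N (U : nat -> A),
  (forall d, sym_graded d (U d)) /\ u = \sum_(d < N) U d.
Proof.
suff [t ht ->] : exists2 t : seq (nat * A),
    forall e, e \in t -> sym_graded e.1 e.2 & u = \sum_(e <- t) e.2.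
  (* Terms of equal degree are collected; the bound is one more than the largest degree. *)
  exists (\max_(e <- t) e.1).+1, (fun d => \sum_(e <- t | e.1 == d) e.2); split.
    by move=> d; rewrite big_seq_cond; apply: sym_graded_sum => e /andP[/ht he /eqP <-].
  rewrite (exchange_big_dep predT) //= big_seq [RHS]big_seq; apply: eq_bigr => e et.
  have le : (e.1 < (\max_(e <- t) e.1).+1)%N by rewrite ltnS; apply: leq_bigmax_seq.
  by rewrite (big_pred1 (Ordinal le)) // => i; rewrite eq_sym.
elim/sym_ind: u => [r|m|u v [t ht eu] [t' ht' ev]|u v [t ht eu] [t' ht' ev]].
- exists [:: (0%N, sconst r)]; rewrite ?big_seq1 // => e.
  by rewrite inE => /eqP ->; exists r.
- exists [:: (1%N, svar m)]; rewrite ?big_seq1 // => e.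
  by rewrite inE => /eqP ->; apply: sym_graded_var.
- exists (t ++ t'); last by rewrite big_cat eu ev.
  by move=> e; rewrite mem_cat => /orP[/ht|/ht'].
exists [seq ((e.1 + e'.1)%N, e.2 * e'.2) | e <- t, e' <- t'].
  move=> _ /allpairsP[[e e'] [/= /ht he /ht' he' ->]]; exact: sym_gradedM.
by rewrite big_allpairs_dep eu ev big_distrlr.
Qed.

Lemma sym_graded_lift d z : z \in ideal_pow I d ->
  exists2 u, sym_graded d u & rees_coef d u = z.
Proof.
elim: d z => [|d IH] z; first by exists (sconst z); [exists z|exact: rees_coef_const].
case/asboolP=> t tP ->; elim: t tP => [|e t IHt] tP.
  by exists 0; [exact: sym_graded0|rewrite big_nil rees_coef0].
have [|u hu eu] := IHt; first by move=> e' e't; apply: tP; rewrite in_cons e't orbT.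
have [a [b [aI bI eab]]] := tP e (mem_head _ _); have [v hv ev] := IH b bI.
exists (sconst e.1 * (svar (Sub a aI : M) * v) + u).
  apply: sym_gradedD => //; apply: (@sym_gradedM 0 d.+1); first by exists e.1.
  by apply: (@sym_gradedM 1 d) => //; apply: sym_graded_var.
rewrite rees_coefD eu big_cons eab -ev; congr (_ + _).
rewrite /rees_coef !rees_valM rees_val_const rees_val_var /=.
by rewrite coefCM -scalerAl coefZ coefXM.
Qed.

(** The part of degree [d] contributes only to the coefficient of ['X^d], so the parts can be
    treated one at a time. *)
Lemma rees_val_inj u : rees_val u = 0 -> u = 0.
Proof.
have [N [U [hU ->]]] := sym_graded_split u.
rewrite (big_morph _ rees_valD rees_val0) => e.
rewrite big1 // => d _; apply: (sym_graded_inj (hU d)).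
have := congr1 (fun p : {poly R} => p`_d) e; rewrite coef0 coef_sum => <-.
rewrite (bigD1 d) //= big1 => [|j jd]; first by rewrite addr0.
by rewrite (rees_val_graded (hU j)) coefZ coefXn eq_sym (inj_eq val_inj) (negPf jd) mulr0.
Qed.

Lemma rees_val_surj (p : {poly R}) : (forall i, p`_i \in ideal_pow I i) ->
  exists u, rees_val u = p.
Proof.
move=> hp; have [U hU] := choice (fun i =>
  let: ex_intro2 u h e := sym_graded_lift (hp i) in
  ex_intro (fun u => sym_graded i u /\ rees_coef i u = p`_i) u (conj h e)).
exists (\sum_(i < size p) U i).
rewrite (big_morph _ rees_valD rees_val0) -[RHS]coefK poly_def.
by apply: eq_bigr => i _; have [h e] := hU i; rewrite (rees_val_graded h) e.
Qed.

End SymToRees.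

Theorem d_sequence_linear_type (R : comNzRingType) (I : submodClosed R^o) (s : seq R) :
  I =i ideal_seq s -> d_sequence s -> linear_type I.
Proof.
move=> Is ds; pose rv (u : sym_alg (ideal_module I)) : {poly R} := val (sym_to_rees u).
have rvD u v : rv (u + v) = rv u + rv v by rewrite /rv /sym_to_rees rmorphD.
have rvM u v : rv (u * v) = rv u * rv v by rewrite /rv /sym_to_rees rmorphM.
have rvC r : rv (sym_const _ r) = r%:P.
  rewrite /rv /sym_to_rees sym_liftE free_evalZ.
  by rewrite (rmorph1 (free_eval (@rees_gen R I))) /= alg_polyC.
have rvV m : rv (sym_var m) = val m *: 'X by rewrite /rv /sym_to_rees sym_lift_var.
have inj := rees_val_inj Is ds (@sym_constD _ _) (@sym_constM _ _) (@sym_const0 _ _)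
  (@sym_const1 _ _) (@sym_var_linear _ _) (@sym_alg_ind _ _) rvD rvM rvC rvV.
have sur := rees_val_surj Is (@sym_constD _ _) (@sym_constM _ _) (@sym_const0 _ _)
  (@sym_const1 _ _) (@sym_var_linear _ _) rvD rvM rvC rvV.
have [g hg] : exists g, forall r, sym_to_rees (g r) = r :> rees_alg I.
  suff /choice[g] : forall r, exists u, sym_to_rees u = r :> rees_alg I by exists g.
  move=> r; have [|u eu] := sur (val r); first by have /asboolP := valP r.
  by exists u; apply: val_inj.
exists g => // u; apply/eqP; rewrite -subr_eq0; apply/eqP/inj.
have stB a b : sym_to_rees (a - b) = sym_to_rees a - sym_to_rees b :> rees_alg I.
  by rewrite /sym_to_rees rmorphB.
by rewrite /rv stB hg subrr.
Qed.

(** * Graphs *)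

Lemma mem_path_edges_iota (V : eqType) (p : nat -> V) c n a b :
  reflect (exists2 j, (c <= j < c + n)%N & (a, b) = (p j, p j.+1))
    ((a, b) \in path_edges (p c) (map p (iota c.+1 n))).
Proof.
elim: n c => [|n IH] c /=.
  by apply: (iffP idP) => // -[j]; rewrite addn0; case: ltngtP.
rewrite mem_rcons inE; apply: (iffP orP) => [[/eqP e|/IH[j jn e]]|[j /andP[cj jn] e]].
- by exists c => //; rewrite leqnn addnS ltnS leq_addr.
- by exists j => //; case/andP: jn => cj jn; rewrite (ltnW cj) addnS -addSn.
move: cj; rewrite leq_eqVlt => /orP[/eqP cj|cj]; first by left; rewrite e cj.
by right; apply/IH; exists j; rewrite // cj addSn -addnS.
Qed.

Lemma path_edges_uniq (V : eqType) (u : V) l : uniq (u :: l) ->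
  uniq (path_edges u l) /\ forall a b, (a, b) \in path_edges u l -> (b, a) \notin path_edges u l.
Proof.
elim: l u => [|v l IH] u // /andP[uv /IH[ue asym]] /=.
have nu a b : (a, b) \in path_edges v l -> a != u /\ b != u.
  by move=> /path_edges_sub[h1 h2]; split; apply: contraNneq uv => <-.
split=> [|a b].
  by rewrite rcons_uniq ue andbT; apply/negP => /nu[/eqP].
rewrite !mem_rcons !inE => /orP[/eqP[-> ->]|ab]; rewrite negb_or.
  rewrite xpair_eqE; apply/andP; split; last by apply/negP => /nu[_ /eqP].
  by apply: contraNN uv => /andP[/eqP <- _]; exact: mem_head.
rewrite (asym _ _ ab) andbT xpair_eqE; have [_ /negPf ->] := nu _ _ ab.
by [].
Qed.

Lemma leg_edges_uniq (V : eqType) (ls : seq (V * seq V)) : uniq (leg_vertices ls) ->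
  uniq (leg_edges ls) /\ forall a b, (a, b) \in leg_edges ls -> (b, a) \notin leg_edges ls.
Proof.
elim: ls => [|e ls IH] //; rewrite leg_vertices_cons -cat_cons cat_uniq.
case/and3P=> /path_edges_uniq[u1 a1] /hasPn dj /IH[u2 a2].
rewrite /leg_edges /= -/(leg_edges ls); split=> [|a b].
  rewrite cat_uniq u1 u2 andbT; apply/hasPn => d /leg_edges_sub[/dj h _].
  by apply: contra h => /path_edges_sub[].
rewrite !mem_cat => /orP[ab|ab]; rewrite negb_or.
  rewrite a1 //=; apply/negP => /leg_edges_sub[_ /dj /negP]; apply.
  by case/path_edges_sub: ab.
rewrite a2 // andbT; apply/negP => /path_edges_sub[h _].
by case/leg_edges_sub: ab => _ /dj /negP; apply.
Qed.

(** Sorting can identify only an edge with its reverse, and the list never contains both; the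
    condition on the heads separates the chord from the other center edges. *)
Lemma spider_chord_uniq n (k0 : 'I_n) (ls : seq ('I_n * seq 'I_n)) w :
  uniq (k0 :: leg_vertices ls) -> w != k0 -> w \notin map fst ls ->
  uniq (map (@sort_edge n) (leg_edges ls ++ [seq (k0, u) | u <- rcons (map fst ls) w])).
Proof.
move=> uls wk wh; have [k0V uV] := andP uls.
have [uE asym] := leg_edges_uniq uV.
set E := _ ++ _.
have hk v : v \in rcons (map fst ls) w -> v != k0.
  rewrite mem_rcons inE => /orP[/eqP->//|/mapP[e els ->]].
  apply: contraNneq k0V => <-; apply/flattenP; exists (e.1 :: e.2); rewrite ?mem_head //.
  exact: (map_f (fun e : 'I_n * seq 'I_n => e.1 :: e.2)).
have nk e : e \in leg_edges ls -> e.1 != k0 /\ e.2 != k0.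
  by case/leg_edges_sub=> h1 h2; split; apply: contraNneq k0V => <-.
have uniqE : uniq E.
  rewrite cat_uniq uE; apply/and3P; split=> //.
    by apply/hasPn => _ /mapP[u _ ->]; apply/negP => /nk[/eqP].
  by rewrite map_inj_uniq ?rcons_uniq ?wh ?(uniq_heads uls) // => a b [].
have asymE a b : (a, b) \in E -> (b, a) \notin E.
  rewrite !mem_cat => /orP[ab|/mapP[u uh [-> ->]]]; rewrite negb_or.
    rewrite asym //=; apply/negP => /mapP[u _ [eb _]].
    by have [_ /eqP] := nk _ ab.
  apply/andP; split; first by apply/negP => /nk[_ /eqP].
  by apply/negP => /mapP[u' _ [e _]]; move: (hk _ uh); rewrite e eqxx.
rewrite map_inj_in_uniq // => -[a b] [c d] abE cdE.
rewrite /sort_edge /=; case: ifP => _; case: ifP => _ // [ea eb].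
- by move: (asymE _ _ abE); rewrite ea eb cdE.
- by move: (asymE _ _ abE); rewrite ea eb cdE.
- by rewrite ea eb.
Qed.

Lemma leg_edgesP (V : eqType) (ls : seq (V * seq V)) e :
  reflect (exists2 d, d \in ls & e \in path_edges d.1 d.2) (e \in leg_edges ls).
Proof.
apply: (iffP flattenP) => [[_ /mapP[d dls ->] ed]|[d dls ed]]; first by exists d.
by exists (path_edges d.1 d.2) => //; apply: (map_f (fun d : V * seq V => path_edges d.1 d.2)).
Qed.

Lemma mem_path_edges_rcons (V : eqType) (u v : V) l e :
  (e \in path_edges u (rcons l v)) = (e == (last u l, v)) || (e \in path_edges u l).
Proof.
elim: l u => [|w l IH] u /=; first by rewrite !inE ?orbF.
by rewrite !mem_rcons !inE IH orbCA.
Qed.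

(** For gluing two legs at their far ends: the second one is traversed backwards, so its edges
    appear reversed. *)
Lemma mem_path_edges_cat_rev (V : eqType) (u v : V) l l' a b :
  ((a, b) \in path_edges u (l ++ rev (v :: l'))) =
  [|| (a, b) \in path_edges u l, (a, b) == (last u l, last v l') | (b, a) \in path_edges v l'].
Proof.
elim: l' v => [|w l' IH] v.
  by rewrite cats1 mem_path_edges_rcons /= orbF orbC.
rewrite rev_cons -rcons_cat mem_path_edges_rcons IH /= mem_rcons inE.
rewrite rev_cons last_cat last_rcons !xpair_eqE [(a == w) && _]andbC.
by do ![case: (_ \in _) => /=]; rewrite ?orbT ?orbF // orbC.
Qed.

(** * Realizing the unicyclic graph as a spider with a chord *)

Section SpiderGraph.
Variables (k : fieldType) (n m : nat) (k0 : 'I_n) (H G : sgraph 'I_n).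
Variables (s : 'I_m -> nat) (f : spider_vertex s -> 'I_n).
Hypotheses (bij_f : bijective f) (fk0 : f None = k0).
Hypothesis Hf : forall a b, H (f a) (f b) = spider_adj a b.
Local Notation V := 'I_n.

(** The vertex [p_(l, j+1)] with a numerical index; [inord] is faithful only for [j <= s l], whence
    the bounds in [P_inj]. *)
Let P (l : 'I_m) (j : nat) : V := f (Some (existT (fun l => 'I_(s l).+1) l (inord j))).

Let P_inj l j l' j' : (j <= s l)%N -> (j' <= s l')%N -> P l j = P l' j' -> l = l' /\ j = j'.
Proof.
move=> hj hj' /(bij_inj bij_f) /(congr1 (fun p : spider_vertex s =>
  if p is Some q then (Some (tag q), val (tagged q)) else (None, 0%N))).
by rewrite /= !inordK // => -[].
Qed.

Let P_neq l j : P l j != k0.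
Proof. by rewrite -fk0 (inj_eq (bij_inj bij_f)). Qed.

Let P_onto a : a = k0 \/ exists l j, (j <= s l)%N /\ a = P l j.
Proof.
have [g _ fg] := bij_f; rewrite -(fg a).
case: (g a) => [[l j]|]; [right|by left].
by exists l, j; rewrite -ltnS ltn_ord /P inord_val.
Qed.

Let H_next l j : (j < s l)%N -> H (P l j) (P l j.+1).
Proof. by move=> hj; rewrite Hf /= !inordK ?eqxx // ltnS // ltnW. Qed.

Let H_head l : H k0 (P l 0).
Proof. by rewrite -fk0 Hf /= inordK. Qed.

Let H_edges a b : H a b ->
  let base a b := (exists l j, [/\ (j < s l)%N, a = P l j & b = P l j.+1]) \/
                  (exists l, a = k0 /\ b = P l 0%N) in base a b \/ base b a.
Proof.
have [g _ fg] := bij_f; rewrite -(fg a) -(fg b) Hf /=.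
case: (g a) => [[l j]|]; case: (g b) => [[l' j']|] //=.
- case/andP=> /eqP ll; subst l'; case/orP=> /eqP jj; [left|right]; left; exists l.
    exists j; rewrite /P inord_val jj inord_val; split=> //.
    by have := ltn_ord j'; rewrite -jj ltnS.
  exists j'; rewrite /P inord_val jj inord_val; split=> //.
  by have := ltn_ord j; rewrite -jj ltnS.
- by move/eqP=> j0; right; right; exists l; rewrite /P -j0 inord_val fk0.
by move/eqP=> j0; left; right; exists l'; rewrite /P -j0 inord_val fk0.
Qed.

Let leg l : V * seq V := (P l 0, map (P l) (iota 1 (s l))).

Let legP l a b : reflect (exists2 j, (j < s l)%N & (a, b) = (P l j, P l j.+1))
  ((a, b) \in path_edges (leg l).1 (leg l).2).
Proof. exact: (mem_path_edges_iota (P l) 0 (s l) a b). Qed.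

Let leg_last l : last (leg l).1 (leg l).2 = P l (s l).
Proof.
rewrite /leg /= last_map; congr P.
by case: (s l) => // j; rewrite -[j.+1]addn1 iotaD last_cat /= add1n addn1.
Qed.

Let legsV : uniq (k0 :: leg_vertices [seq leg l | l <- enum 'I_m]).
Proof.
have -> : leg_vertices [seq leg l | l <- enum 'I_m] =
    [seq P l j | l <- enum 'I_m, j <- iota 0 (s l).+1].
  by rewrite /leg_vertices -map_comp.
rewrite cons_uniq; apply/andP; split.
  by apply/negP => /allpairsPdep[l [j [_ _ e]]]; have := P_neq l j; rewrite -e eqxx.
apply: allpairs_uniq_dep => [|l _|]; rewrite ?enum_uniq ?iota_uniq //.
move=> _ _ /allpairsPdep[l [j [_ hj ->]]] /allpairsPdep[l' [j' [_ hj' ->]]] /=.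
rewrite !mem_iota /= !add0n !ltnS in hj hj'.
by move=> /(P_inj hj hj')[<- <-].
Qed.

(** Every other vertex has two distinct neighbors: the center because there are at least two legs,
    the remaining vertices because they have one on either side. *)
Let pendant_end a : (2 <= m)%N -> pendant H a -> exists l, a = P l (s l).
Proof.
move=> m2 pa.
have two b c : b != c -> H a b -> H a c -> False.
  move=> bc ab ac; move: pa; rewrite /pendant /degree => /eqP h1.
  have : (#|[set b; c]| <= 1)%N.
    rewrite -h1; apply/subset_leq_card/subsetP => d.
    by rewrite !inE => /orP[] /eqP->.
  by rewrite cards2 bc.
have [a0|[l [j [jl aP]]]] := P_onto a.
  case: m m2 s f P P_inj H_head two a0 => [|[|m']] // _ s' f' P' inj' head' two' a0.
  case: (two' (P' ord0 0%N) (P' ord_max 0%N)); rewrite ?a0 //.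
  by apply/eqP => /inj'[] // /(congr1 val).
have [jl'|sj] := ltnP j (s l); last first.
  by exists l; rewrite aP; congr P; apply/eqP; rewrite eqn_leq jl.
exfalso; case: j => [|j] in jl aP jl' *.
  apply: (two k0 (P l 1)); rewrite ?aP ?H_next 1?eq_sym ?P_neq //.
  by rewrite adj_sym H_head.
apply: (two (P l j) (P l j.+2)); rewrite ?aP ?H_next //; last first.
  by rewrite adj_sym H_next // ltnW.
apply/eqP => e; have [||_ /eqP] := P_inj _ _ e; rewrite ?(ltnW jl) //.
by rewrite -[j.+2]addn2 -{1}[j]addn0 eqn_add2l.
Qed.

Let HG_edges u v : adds_edge H G u v -> (forall a b, H a b -> G a b) /\ G u v.
Proof. by case=> _ _ GE; split=> [a b ab|]; rewrite GE ?ab // !eqxx orbT. Qed.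

(** This serves cases (a) and (c). As [w] is not adjacent to the center in [H], it is not the
    initial vertex of a leg. *)
Let d_sequence_center w : adds_edge H G k0 w -> edge_binomials_form_d_sequence k G.
Proof.
move=> hadd; have [kw nH GE] := hadd; have [HG Gw] := HG_edges hadd.
have wh : w \notin map fst [seq leg l | l <- enum 'I_m].
  by rewrite -map_comp; apply: contra nH => /mapP[l _ ->]; apply: H_head.
have wk : w != k0 by rewrite eq_sym.
apply: (edge_binomials_d_sequence k legsV wk); first exact: spider_chord_uniq legsV wk wh.
set E := _ ++ _.
have EG e : e \in E -> G e.1 e.2.
  rewrite mem_cat => /orP[/leg_edgesP[_ /mapP[l _ ->]]|/mapP[u]].
    by case: e => a b /legP[j js [-> ->]]; apply/HG/H_next.
  rewrite mem_rcons inE => /orP[/eqP-> -> //|]; rewrite -map_comp => /mapP[l _ -> ->].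
  exact/HG/H_head.
have legE l a b : (a, b) \in path_edges (leg l).1 (leg l).2 -> (a, b) \in E.
  move=> ab; rewrite mem_cat; apply/orP; left; apply/leg_edgesP.
  by exists (leg l) => //; apply: map_f; rewrite mem_enum.
have baseE a b : (exists l j, [/\ (j < s l)%N, a = P l j & b = P l j.+1]) \/
    (exists l, a = k0 /\ b = P l 0%N) -> (a, b) \in E.
  case=> [[l [j [js -> ->]]]|[l [-> ->]]]; first by apply: (legE l); apply/legP; exists j.
  rewrite mem_cat; apply/orP; right; apply: map_f.
  by rewrite mem_rcons inE -map_comp (map_f _ (mem_enum _ l)) orbT.
have wE : (k0, w) \in E.
  by rewrite mem_cat; apply/orP; right; apply: map_f; rewrite mem_rcons mem_head.
move=> a b; apply/idP/idP => [|/orP[/EG //|/EG]]; last by rewrite adj_sym.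
rewrite GE => /or3P[/H_edges[]/baseE -> //|/andP[/eqP-> /eqP->]|/andP[/eqP-> /eqP->]];
  by rewrite ?wE ?orbT.
Qed.

(* The new edge joins the ends of the legs [i] and [i']: the first leg of the
   new spider runs along [i] and back along [i'], and its chord joins the center
   to the initial vertex of [i']. *)
Let d_sequence_ends i i' : adds_edge H G (P i (s i)) (P i' (s i')) ->
  edge_binomials_form_d_sequence k G.
Proof.
move=> hadd; have [uv nH GE] := hadd; have [HG Gw] := HG_edges hadd.
have ii : i != i' by apply: contraNneq uv => ->.
pose r := [seq l <- enum 'I_m | (l != i) && (l != i')].
pose ls := ((leg i).1, (leg i).2 ++ rev ((leg i').1 :: (leg i').2)) :: map leg r.
have pr : perm_eq (enum 'I_m) [:: i, i' & r].
  apply: uniq_perm => [||l]; first exact: enum_uniq.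
    by rewrite /= !inE negb_or ii !mem_filter !eqxx andbF filter_uniq ?enum_uniq.
  rewrite mem_enum !inE mem_filter mem_enum andbT.
  by case: eqP => //= _; case: eqP.
have uls : uniq (k0 :: leg_vertices ls).
  have pv : perm_eq (k0 :: leg_vertices [seq leg l | l <- enum 'I_m]) (k0 :: leg_vertices ls).
    rewrite perm_cons; apply: perm_trans (perm_flatten (perm_map _ (perm_map _ pr))) _.
    pose A := (leg i).1 :: (leg i).2; pose B := (leg i').1 :: (leg i').2.
    suff : perm_eq (A ++ B ++ leg_vertices (map leg r))
      ((A ++ rev B) ++ leg_vertices (map leg r)) by [].
    by rewrite -catA perm_cat2l perm_cat2r perm_sym perm_rev.
  by rewrite -(perm_uniq pv).
have wk : P i' 0 != k0 by [].
have wh : P i' 0 \notin map fst ls.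
  rewrite /= inE negb_or -map_comp; apply/andP; split.
    by apply/eqP => /P_inj[] // /eqP; rewrite eq_sym (negPf ii).
  apply/negP => /mapP[l]; rewrite mem_filter => /andP[/andP[_ li'] _].
  by move=> /P_inj[] // /eqP; rewrite eq_sym (negPf li').
apply: (edge_binomials_d_sequence k uls wk); first exact: spider_chord_uniq uls wk wh.
set E := _ ++ _.
have EG e : e \in E -> G e.1 e.2.
  rewrite mem_cat => /orP[/leg_edgesP[d]|/mapP[u]].
    rewrite inE => /orP[/eqP->|/mapP[l _ ->]].
      case: e => a b; rewrite mem_path_edges_cat_rev !leg_last.
      case/or3P=> [/legP[j js [-> ->]]|/eqP[-> ->] //|/legP[j js [-> ->]]].
        exact/HG/H_next.
      by rewrite adj_sym; apply/HG/H_next.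
    by case: e => a b /legP[j js [-> ->]]; apply/HG/H_next.
  rewrite mem_rcons inE => /orP[/eqP-> ->|/mapP[d]]; first exact/HG/H_head.
  by rewrite inE => /orP[/eqP->|/mapP[l _ ->]] -> ->; apply/HG/H_head.
have mem_r l : [|| l == i, l == i' | l \in r].
  by have := perm_mem pr l; rewrite mem_enum !inE.
have legE a b : (a, b) \in path_edges (leg i).1 ((leg i).2 ++ rev ((leg i').1 :: (leg i').2)) ->
    (a, b) \in E.
  move=> ab; rewrite mem_cat; apply/orP; left; apply/leg_edgesP.
  by exists ((leg i).1, (leg i).2 ++ rev ((leg i').1 :: (leg i').2)); rewrite ?mem_head.
have starE v : v \in rcons (map fst ls) (P i' 0) -> (k0, v) \in E.
  by move=> hv; rewrite mem_cat (map_f _ hv) orbT.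
have baseE a b : (exists l j, [/\ (j < s l)%N, a = P l j & b = P l j.+1]) \/
    (exists l, a = k0 /\ b = P l 0%N) -> ((a, b) \in E) || ((b, a) \in E).
  case=> [[l [j [js ea eb]]]|[l [-> ->]]].
    have abl : (a, b) \in path_edges (leg l).1 (leg l).2 by apply/legP; exists j; rewrite ?ea ?eb.
    case/or3P: (mem_r l) => [/eqP li|/eqP li|lr].
    - by rewrite legE // mem_path_edges_cat_rev -li abl.
    - by rewrite (legE b) ?orbT // mem_path_edges_cat_rev -li abl !orbT.
    apply/orP; left; rewrite mem_cat; apply/orP; left; apply/leg_edgesP; exists (leg l) => //.
    by rewrite in_cons (map_f leg lr) orbT.
  rewrite starE // mem_rcons in_cons; case/or3P: (mem_r l) => [/eqP->|/eqP->|lr].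
  - by apply/orP; right; apply: mem_head.
  - by rewrite eqxx.
  apply/orP; right; apply/mapP; exists (leg l) => //.
  by rewrite in_cons (map_f leg lr) orbT.
have newE : (P i (s i), P i' (s i')) \in E.
  by apply: legE; rewrite mem_path_edges_cat_rev !leg_last eqxx orbT.
move=> a b; apply/idP/idP => [|/orP[/EG //|/EG]]; last by rewrite adj_sym.
rewrite GE => /or3P[/H_edges[]/baseE //|/andP[/eqP-> /eqP->]|/andP[/eqP-> /eqP->]].
- by rewrite orbC.
- by rewrite newE.
- by rewrite newE orbT.
Qed.

Lemma spider_unicyclic_d_sequence u v : (2 <= m)%N -> adds_edge H G u v ->
  [\/ pendant H u /\ v = k0, pendant H u /\ pendant H v | u = k0 /\ internal H v] ->
  edge_binomials_form_d_sequence k G.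
Proof.
move=> m2 hadd [[_ vk]|[pu pv]|[uk _]].
(* In case (a) the center is the second endpoint, so the endpoints are exchanged. *)
- apply: (@d_sequence_center u); case: hadd => uv nH GE; rewrite -vk; split=> [||a b].
  + by rewrite eq_sym.
  + by rewrite adj_sym.
  by rewrite GE orbCA orbC -orbA; congr (_ || _); rewrite orbC.
- have [i ui] := pendant_end m2 pu; have [i' vi] := pendant_end m2 pv.
  by apply: (@d_sequence_ends i i'); rewrite -ui -vi.
by apply: (@d_sequence_center v); rewrite -uk.
Qed.

End SpiderGraph.

Lemma binomial_edge_ideal_seq (k : fieldType) n (G : sgraph 'I_n) :
  binomial_edge_ideal k G =i ideal_seq (edge_binomials k G).
Proof.
move=> z; apply/idP/idP => [/asboolP[t tG ->]|/asboolP[t tG ->]]; last first.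
  apply/asboolP; exists t => // u /tG /mapP[[i j]]; rewrite mem_filter /=.
  by case/andP=> /andP[_ ij] _ ->; exists i, j.
rewrite big_seq; apply: ideal_sum => u /tG[i [j [ij ->]]]; apply: idealMl.
have mem (a b : 'I_n) : (a < b)%N -> G a b -> edge_binomial k a b \in ideal_seq (edge_binomials k G).
  move=> ab Gab; apply: ideal_mem; apply/mapP; exists (a, b) => //.
  by rewrite mem_filter /= ab Gab mem_enum.
have [lt|gt|eq] := ltngtP i j; first exact: mem.
  rewrite (_ : edge_binomial k i j = - edge_binomial k j i); last by rewrite /edge_binomial; ring.
  by apply/idealN/mem; rewrite // adj_sym.
by move: ij; rewrite (ord_inj eq) adj_irrefl.
Qed.

Theorem theorem2p1 (k : fieldType) (m n : nat) (H G : sgraph 'I_n)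
    (k0 u v : 'I_n) (hm : (2 <= m)%N) (hH : in_class_T m H k0)
    (hG : unicyclic G) (hadd : adds_edge H G u v)
    (huv : [\/ pendant H u /\ v = k0,
               pendant H u /\ pendant H v |
               u = k0 /\ internal H v]) :
  edge_binomials_form_d_sequence k G /\ linear_type (binomial_edge_ideal k G).
Proof.
have [s [f [bij_f fk0 Hf]]] := hH.
have [t [pt dt]] := spider_unicyclic_d_sequence k bij_f fk0 Hf hm hadd huv.
split; first by exists t.
apply: (d_sequence_linear_type (s := t)) => // z.
by rewrite binomial_edge_ideal_seq; apply: eq_ideal_mem => a; rewrite (perm_mem pt).
Qed.
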